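(* Let $R_s>0$ and $\lambda=2^{R_s}$. Let $\gamma_d,\gamma_e$ be independent random variables, where for $t\in\{d,e\}$, $\gamma_t$ follows the generalized-$K$ distribution with parameters $m_t>0$, $k_t>0$ and mean $\overline\gamma_t>0$, i.e. its CDF is $$F_{\gamma_t}(x)=\frac{1}{\Gamma(k_t)\Gamma(m_t)}\,G_{1,3}^{2,1}\!\left(\frac{k_t m_t x}{\overline\gamma_t}\,\middle|\,{1 \atop k_t,\,m_t,\,0}\right),\quad x\ge 0.$$ Let $\sigma_e^2$ denote the variance of $\gamma_e$, let $P(x)=F_{\gamma_d}(\lambda-1+\lambda x)$, and define the second-order approximation of the secrecy outage probability $P_{\rm sop}=\mathbb{E}\{F_{\gamma_d}(\lambda-1+\lambda\gamma_e)\}$ by $$\widetilde P_{\rm sop}:=P(\overline\gamma_e)+\frac{\sigma_e^2}{2}P''(\overline\gamma_e).$$ Then $$\widetilde P_{\rm sop}=\frac{G_{1,3}^{2,1}\!\left(\frac{k_d m_d(\lambda-1+\lambda\overline\gamma_e)}{\overline\gamma_d}\,\middle|\,{1\atop k_d,\,m_d,\,0}\right)}{\Gamma(k_d)\Gamma(m_d)}+\overline\gamma_e^2\lambda^2\,\frac{\left(\frac{(k_e+1)(m_e+1)}{k_em_e}-1\right)G_{2,4}^{2,2}\!\left(\frac{k_dm_d(\lambda-1+\lambda\overline\gamma_e)}{\overline\gamma_d}\,\middle|\,{0,\,1\atop k_d,\,m_d,\,0,\,2}\right)}{2\Gamma(k_d)\Gamma(m_d)(\lambda-1+\lambda\overl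ine\gamma_e)^2}.$$
   Context: $G^{m,n}_{p,q}\left(z\,\middle|\,{a_1,\dots,a_p\atop b_1,\dots,b_q}\right)$ denotes the standard Meijer G-function with upper parameters $a_i$ and lower parameters $b_j$; $\Gamma$ is the Gamma function. The generalized-$K$ distribution with parameters $k,m$ and mean $\overline\gamma$ is that of $\overline\gamma XY$ with $X,Y$ independent Gamma variables of shapes $k$ and $m$ and unit means. $P''$ denotes the second derivative of $P$. *)

(* Defs.v *)
From Stdlib Require Import Reals List Factorial.
From Coquelicot Require Import Coquelicot.
Import ListNotations.
Open Scope R_scope.

Definition cpowR (z : R) (s : C) : C :=
  (exp (fst s * ln z) * cos (snd s * ln z), exp (fst s * ln z) * sin (snd s * ln z)).

(* Gauss' product formula: Gamma(s) = lim_n n! n^s / (s (s+1) ... (s+n)) *)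
Definition gauss_seq (s : C) (n : nat) : C :=
  Cdiv (Cmult (RtoC (INR (fact n))) (cpowR (INR n) s))
       (fold_right Cmult (RtoC 1) (map (fun k => Cplus s (RtoC (INR k))) (seq 0 (S n)))).

Definition CGamma (s : C) : C :=
  (real (Lim_seq (fun n => fst (gauss_seq s n))),
   real (Lim_seq (fun n => snd (gauss_seq s n)))).

Definition Gamma (x : R) : R := fst (CGamma (RtoC x)).

Definition Cprod (l : list C) : C := fold_right Cmult (RtoC 1) l.

(* Mellin-Barnes integrand of G^{m,n}_{p,q}(z | a ; b), p = length a, q = length b *)
Definition meijer_integrand (m n : nat) (a b : list R) (z : R) (s : C) : C :=
  Cmult
    (Cdiv
      (Cmult (Cprod (map (fun bj => CGamma (Cminus (RtoC bj) s)) (firstn m b)))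
             (Cprod (map (fun aj => CGamma (Cplus (RtoC (1 - aj)) s)) (firstn n a))))
      (Cmult (Cprod (map (fun bj => CGamma (Cplus (RtoC (1 - bj)) s)) (skipn m b)))
             (Cprod (map (fun aj => CGamma (Cminus (RtoC aj) s)) (skipn n a)))))
    (cpowR z s).

(* abscissa of the vertical contour Re s = c, chosen in the middle of the strip
   max_{j<=n} (a_j - 1) < c < min_{j<=m} b_j separating the two families of poles *)
Definition meijer_lo (n : nat) (a : list R) : option R :=
  match firstn n a with
  | [] => None
  | x :: l => Some (fold_right Rmax (x - 1) (map (fun y => y - 1) l))
  end.
Definition meijer_hi (m : nat) (b : list R) : option R :=
  match firstn m b with
  | [] => None
  | x :: l => Some (fold_right Rmin x l)
  end.
Definition meijer_c (m n : nat) (a b : list R) : R :=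
  match meijer_lo n a, meijer_hi m b with
  | Some lo, Some hi => (lo + hi) / 2
  | Some lo, None => lo + 1
  | None, Some hi => hi - 1
  | None, None => 0
  end.

(* G^{m,n}_{p,q}(z | a ; b) = (1/(2 pi i)) \int_{c - i oo}^{c + i oo} integrand(s) ds
   = (1/(2 pi)) \int_{-oo}^{+oo} integrand(c + i t) dt.
   For real parameters and z > 0 the value is real; we return its real part. *)
Definition MeijerG (m n : nat) (a b : list R) (z : R) : R :=
  / (2 * PI) *
  RInt_gen (fun t => fst (meijer_integrand m n a b z (meijer_c m n a b, t)))
           (Rbar_locally m_infty) (Rbar_locally p_infty).

Definition genK_cdf (k m g x : R) : R :=
  if Rle_dec 0 x then MeijerG 2 1 [1] [k; m; 0] (k * m * x / g) / (Gamma k * Gamma m)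
  else 0.

Definition gamma_unit_pdf (k x : R) : R :=
  Rpower k k * Rpower x (k - 1) * exp (- (k * x)) / Gamma k.

(* j-th moment of g X Y, X ~ Gamma(k) and Y ~ Gamma(m) independent with unit means *)
Definition genK_moment (k m g : R) (j : nat) : R :=
  RInt_gen (fun x =>
     RInt_gen (fun y => (g * x * y) ^ j * gamma_unit_pdf k x * gamma_unit_pdf m y)
              (at_right 0) (Rbar_locally p_infty))
    (at_right 0) (Rbar_locally p_infty).

Definition genK_var (k m g : R) : R :=
  genK_moment k m g 2 - (genK_moment k m g 1) ^ 2.

(* Main.v *)
Require Import Defs.
From Stdlib Require Import Reals List Factorial Lra Lia.
From Coquelicot Require Import Coquelicot.
Import ListNotations.
Open Scope R_scope.
Set Bullet Behavior "Strict Subproofs".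

(* On the contour [Re s = c = min(k, m) / 2] the integrand of the first G-function is
   [Gamma(k-s) Gamma(m-s) / s * z^s], because [Gamma(s) / Gamma(1+s) = 1/s], and that of the
   second is [(s-1) Gamma(k-s) Gamma(m-s) * z^s], because [Gamma(s) / Gamma(s-1) = s-1]. As
   [z = e^w] turns [z^s] into [e^(s w)], differentiating in [w] multiplies the integrand by [s],
   so [z^2 G''], i.e. [s (s-1)] in the integrand, sends the first function to the second.
   Differentiating under the integral needs only the decay [Gamma(x+it) = O(1/(1+t^2))], from
   [Gamma(s) = Gamma(s+2) / (s (s+1))] and [|Gamma(s)| <= Gamma(Re s)].
   The variance needs Euler's integral for Gauss' product, which follows in Bohr-Mollerup style
   from the recurrence and from [I(x+a) <= x^a I(x)] for [0 <= a <= 1]. *)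

(** * Improper integrals *)

(** [Lim_seq] and [RInt_gen] are total and return some default when nothing converges, so each
    identity below rests on a convergence proof. For [CGamma], consecutive terms of Gauss' sequence
    have ratio 1 + O(1/n^2), uniformly on bounded segments of a vertical line with Re s > 0. The
    resulting error D/n yields the limit and the continuity of t |-> Gamma(x+it), which
    integrability needs. Cancelling Gamma factors also requires Gamma(s) <> 0 for Re s > 0; this
    comes from a lower bound on |[gauss_seq]| relative to the real sequence, with a factor
    independent of n.

    Both G-functions receive the same abscissa, because the largest a_j - 1 is 0 for each, so they
    are compared on a single line and no contour is ever moved. The delicate point is s = 1, which
    lies on that line when min(k, m) = 2: there Gamma(s-1) is at its pole.

    Euler's integral carries a free rate mu because a Gamma variable of shape k and unit mean has
    rate k. Gauss' limit does not involve mu, so uniqueness of limits replaces a change of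
    variables. *)

Lemma ball_R_between (x y : R) (e : posreal) : ball x e y -> x - e < y < x + e.
Proof. intros H. apply Rabs_lt_between' in H. exact H. Qed.

(** The integral of a nonnegative function grows with the interval, so it converges to the supremum
    of its values. The predicates [Pa] and [Pb] describe admissible endpoints, so that one lemma
    serves both the line and the half-line. *)
Lemma ex_RInt_gen_nonneg_bounded (Fa Fb : (R -> Prop) -> Prop)
  {FFa : ProperFilter Fa} {FFb : ProperFilter Fb}
  (Pa Pb : R -> Prop) (f : R -> R) (B : R) :
  Fa Pa -> Fb Pb ->
  (forall a, Pa a -> Fa (fun a' => a' <= a)) ->
  (forall b, Pb b -> Fb (fun b' => b <= b')) ->
  (forall a b, Pa a -> Pb b ->
     a <= b /\ ex_RInt f a b /\ RInt f a b <= B /\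
     (forall x, a <= x <= b -> 0 <= f x)) ->
  ex_RInt_gen f Fa Fb.
Proof.
  intros HPa HPb HFa HFb H.
  set (E := fun r : R => exists a b, Pa a /\ Pb b /\ r = RInt f a b).
  destruct (filter_ex _ HPa) as [a1 Ha1].
  destruct (filter_ex _ HPb) as [b1 Hb1].
  destruct (completeness E) as [l [Hub Hlub]].
  - exists B. intros r (a & b & Ha & Hb & ->). apply (H a b Ha Hb).
  - exists (RInt f a1 b1), a1, b1. auto.
  - exists l. intros Q [eps HQ].
    assert (Hex : exists a0 b0, Pa a0 /\ Pb b0 /\ l - eps < RInt f a0 b0).
    { apply Classical_Prop.NNPP. intros Hn.
      assert (l <= l - eps).
      { apply Hlub. intros r (a & b & Ha & Hb & ->).
        apply Rnot_lt_le. intros Hlt. apply Hn. exists a, b. auto. }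
      generalize (cond_pos eps). lra. }
    destruct Hex as (a0 & b0 & Ha0 & Hb0 & Hl0).
    exists (fun a => Pa a /\ a <= a0) (fun b => Pb b /\ b0 <= b).
    + apply filter_and; auto.
    + apply filter_and; auto.
    + intros a b [Ha Haa] [Hb Hbb].
      destruct (H a b Ha Hb) as (Hab & Hint & _ & Hpos).
      destruct (H a0 b0 Ha0 Hb0) as (Hab0 & Hint0 & _ & _).
      exists (RInt f a b). simpl. split.
      * apply (RInt_correct (V := R_CompleteNormedModule)), Hint.
      * apply HQ.
        assert (I1 : ex_RInt f a a0) by (apply (ex_RInt_Chasles_1 (V := R_CompleteNormedModule)) with b; [lra|exact Hint]).
        assert (I2 : ex_RInt f a0 b) by (apply (ex_RInt_Chasles_2 (V := R_CompleteNormedModule)) with a; [lra|exact Hint]).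
        assert (I3 : ex_RInt f b0 b) by (apply (ex_RInt_Chasles_2 (V := R_CompleteNormedModule)) with a0; [lra|exact I2]).
        assert (E1 : RInt f a b = RInt f a a0 + RInt f a0 b0 + RInt f b0 b).
        { rewrite <- (RInt_Chasles f a a0 b I1 I2), <- (RInt_Chasles f a0 b0 b Hint0 I3).
          unfold plus; simpl; ring. }
        assert (0 <= RInt f a a0) by (apply RInt_ge_0; [lra|exact I1|intros; apply Hpos; lra]).
        assert (0 <= RInt f b0 b) by (apply RInt_ge_0; [lra|exact I3|intros; apply Hpos; lra]).
        assert (RInt f a b <= l) by (apply Hub; exists a, b; auto).
        unfold ball; simpl; unfold AbsRing_ball, abs, minus, plus, opp; simpl.
        apply Rabs_def1; lra.
Qed.

Notation RInt_line f := (RInt_gen f (Rbar_locally m_infty) (Rbar_locally p_infty)).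
Notation ex_RInt_line f := (ex_RInt_gen f (Rbar_locally m_infty) (Rbar_locally p_infty)).
Notation is_RInt_line f := (is_RInt_gen f (Rbar_locally m_infty) (Rbar_locally p_infty)).

Lemma filter_prod_line (P : R * R -> Prop) :
  (forall a b, a <= 0 -> 0 <= b -> P (a, b)) ->
  filter_prod (Rbar_locally m_infty) (Rbar_locally p_infty) P.
Proof.
  intros H. exists (fun a => a <= 0) (fun b => 0 <= b).
  - exists 0. intros; lra.
  - exists 0. intros; lra.
  - exact H.
Qed.

Lemma is_RInt_line_correct (f : R -> R) : ex_RInt_line f -> is_RInt_line f (RInt_line f).
Proof. intros H; apply @RInt_gen_correct; [apply Proper_StrongProper, Rbar_locally_filter..|exact H]. Qed.

Lemma is_RInt_line_unique (f : R -> R) l : is_RInt_line f l -> RInt_line f = l.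
Proof. intros H; apply @is_RInt_gen_unique; [apply Proper_StrongProper, Rbar_locally_filter..|exact H]. Qed.

(** The antiderivative [C * atan t] of the majorant bounds every partial integral by [C * PI]. *)
Lemma ex_RInt_line_nonneg (f : R -> R) (C : R) :
  (forall t, continuous f t) -> (forall t, 0 <= f t <= C / (1 + t ^ 2)) ->
  ex_RInt_line f.
Proof.
  intros Hc Hf.
  assert (HC : 0 <= C).
  { generalize (Hf 0). replace (C / (1 + 0 ^ 2)) with C by field. lra. }
  apply (ex_RInt_gen_nonneg_bounded _ _ (fun a => a <= 0) (fun b => 0 <= b) f (C * PI)).
  - exists 0. intros; lra.
  - exists 0. intros; lra.
  - intros a _. exists a. intros; lra.
  - intros b _. exists b. intros; lra.
  - intros a b Ha Hb.
    assert (Hex : forall u v, ex_RInt f u v)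
      by (intros u v; apply (ex_RInt_continuous (V := R_CompleteNormedModule)); auto).
    assert (HI : is_RInt (fun t => C / (1 + t ^ 2)) a b (C * atan b - C * atan a)).
    { apply (is_RInt_derive (fun t => C * atan t)).
      - intros x _. evar_last. apply (is_derive_scal atan). apply is_derive_Reals, derivable_pt_lim_atan.
        simpl. unfold Rdiv. reflexivity.
      - intros x _. apply @ex_derive_continuous. auto_derive. nra. }
    repeat split; auto; try lra.
    + apply Rle_trans with (RInt (fun t => C / (1 + t ^ 2)) a b).
      * apply RInt_le; auto; try lra. eexists; exact HI. intros; apply Hf.
      * rewrite (is_RInt_unique _ _ _ _ HI).
        generalize (atan_bound a) (atan_bound b). nra.
    + intros x _. apply Hf.
Qed.

(** Adding the majorant to [f] gives a nonnegative function below twice the majorant; [f] is then a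
    difference of two integrable nonnegative functions. *)
Lemma ex_RInt_line_dom (f : R -> R) (C : R) :
  (forall t, continuous f t) -> (forall t, Rabs (f t) <= C / (1 + t ^ 2)) ->
  ex_RInt_line f.
Proof.
  intros Hc Hf.
  assert (Hg : forall t, continuous (fun t => C / (1 + t ^ 2)) t)
    by (intros t; apply @ex_derive_continuous; auto_derive; nra).
  destruct (ex_RInt_line_nonneg (fun t => f t + C / (1 + t ^ 2)) (2 * C)) as [l1 H1].
  - intros t. apply @continuous_plus; auto.
  - intros t. generalize (Hf t). intros H. apply Rabs_le_between in H.
    replace (2 * C / (1 + t ^ 2)) with (2 * (C / (1 + t ^ 2))) by (unfold Rdiv; ring). lra.
  - destruct (ex_RInt_line_nonneg (fun t => C / (1 + t ^ 2)) C) as [l2 H2]; auto.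
    + intros t. generalize (Hf t) (Rabs_pos (f t)). lra.
    + exists (minus l1 l2).
      eapply is_RInt_gen_ext; [|exact (is_RInt_gen_minus _ _ _ _ H1 H2)].
      apply filter_prod_line. intros a b _ _ x _. unfold minus, plus, opp; simpl. ring.
Qed.

Definition cauchy_mass : R := RInt_line (fun t => / (1 + t ^ 2)).

Lemma RInt_line_bound (f : R -> R) (C l : R) :
  (forall t, Rabs (f t) <= C / (1 + t ^ 2)) -> is_RInt_line f l ->
  Rabs l <= C * cauchy_mass.
Proof.
  intros Hf Hl.
  assert (Hm : is_RInt_line (fun t => / (1 + t ^ 2)) cauchy_mass).
  { apply is_RInt_line_correct, ex_RInt_line_nonneg with 1.
    - intros t; apply @ex_derive_continuous; auto_derive; nra.
    - intros t. split. left; apply Rinv_0_lt_compat; nra. unfold Rdiv; lra. }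
  apply (RInt_gen_norm (V := R_CompleteNormedModule) (Fa := Rbar_locally m_infty) (Fb := Rbar_locally p_infty) f (fun t => C / (1 + t ^ 2))).
  - apply filter_prod_line. simpl; intros; lra.
  - apply filter_prod_line. intros a b _ _ x _. apply Hf.
  - exact Hl.
  - apply (is_RInt_gen_scal _ C _ Hm).
Qed.

(** The exception at 0 serves the contour through s = 1: there the recurrence for Gamma(s-1) would
    divide by 0. *)
Lemma RInt_line_ext_except_0 (f g : R -> R) :
  (forall t, t <> 0 -> f t = g t) -> ex_RInt_line f -> RInt_line g = RInt_line f.
Proof.
  intros Hfg Hex. apply is_RInt_line_unique.
  generalize (is_RInt_line_correct _ Hex). intros H P HP.
  destruct (H P HP) as [Q1 Q2 HQ1 HQ2 HQ].
  exists (fun a => Q1 a /\ a < 0) (fun b => Q2 b /\ 0 < b).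
  - apply filter_and; auto. exists 0; auto.
  - apply filter_and; auto. exists 0; auto.
  - intros a b [Ha Ha0] [Hb Hb0]. destruct (HQ a b Ha Hb) as [y [Hy HPy]].
    exists y. split; auto. simpl in *.
    assert (E0 : ex_RInt f a b) by (eexists; exact Hy).
    assert (E1 : ex_RInt f a 0) by (apply (ex_RInt_Chasles_1 (V := R_CompleteNormedModule)) with b; [lra|exact E0]).
    assert (E2 : ex_RInt f 0 b) by (apply (ex_RInt_Chasles_2 (V := R_CompleteNormedModule)) with a; [lra|exact E0]).
    rewrite <- (is_RInt_unique _ _ _ _ Hy), <- (RInt_Chasles f a 0 b E1 E2).
    (* Extensionality of the integral only asks for equality inside the interval, so cutting at 0
       hides the exceptional point. *)
    apply (is_RInt_Chasles (V := R_CompleteNormedModule)) with 0.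
    + apply (is_RInt_ext (V := R_CompleteNormedModule)) with f; [|apply (RInt_correct (V := R_CompleteNormedModule)), E1].
      intros x. rewrite Rmin_left, Rmax_right by lra. intros; apply Hfg; lra.
    + apply (is_RInt_ext (V := R_CompleteNormedModule)) with f; [|apply (RInt_correct (V := R_CompleteNormedModule)), E2].
      intros x. rewrite Rmin_left, Rmax_right by lra. intros; apply Hfg; lra.
Qed.

(** * Differentiation under the integral sign *)

(** Two uses of the mean value theorem, which give the constant [M] instead of the sharp [M / 2]. *)
Lemma taylor_order_1 (f f1 f2 : R -> R) (x y M : R) :
  (forall z, Rmin x y <= z <= Rmax x y -> is_derive f z (f1 z)) ->
  (forall z, Rmin x y <= z <= Rmax x y -> is_derive f1 z (f2 z)) ->
  (forall z, Rmin x y <= z <= Rmax x y -> Rabs (f2 z) <= M) ->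
  Rabs (f y - f x - f1 x * (y - x)) <= M * (y - x) ^ 2.
Proof.
  intros H1 H2 HM.
  destruct (MVT_gen f x y f1) as [c [Hc Ec]].
  - intros z Hz; apply H1; lra.
  - intros z Hz. apply continuity_pt_filterlim, (@ex_derive_continuous R_AbsRing R_NormedModule). eexists; apply H1; lra.
  - assert (Hin : forall z, Rmin x c <= z <= Rmax x c -> Rmin x y <= z <= Rmax x y).
    { intros z. unfold Rmin, Rmax in *.
      repeat destruct Rle_dec; lra. }
    destruct (MVT_gen f1 x c f2) as [d [Hd Ed]].
    + intros z Hz; apply H2, Hin; lra.
    + intros z Hz. apply continuity_pt_filterlim, (@ex_derive_continuous R_AbsRing R_NormedModule). eexists; apply H2, Hin; lra.
    + rewrite Ec. replace (f1 c * (y - x) - f1 x * (y - x)) with ((f1 c - f1 x) * (y - x)) by ring.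
      rewrite Ed, !Rabs_mult.
      assert (Hcx : Rabs (c - x) <= Rabs (y - x)).
      { unfold Rmin, Rmax in Hc. destruct Rle_dec; unfold Rabs; repeat destruct Rcase_abs; lra. }
      generalize (HM d (Hin d Hd)) (Rabs_pos (f2 d)) (Rabs_pos (c - x)) (Rabs_pos (y - x)). intros.
      rewrite <- (pow2_abs (y - x)).
      replace (M * Rabs (y - x) ^ 2) with (M * Rabs (y - x) * Rabs (y - x)) by ring.
      apply Rmult_le_compat_r; auto.
      apply Rmult_le_compat; auto.
Qed.

(** A dominated second derivative takes the place of dominated convergence: the first-order Taylor
    error of the integrand is at most C d^2 / (1 + t^2), so that of the integral is O(d^2). *)
Lemma is_derive_RInt_line (h h1 h2 : R -> R -> R) (x0 C : R) :
  (forall x, ex_RInt_line (h x)) -> ex_RInt_line (h1 x0) ->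
  (forall x t, is_derive (fun y => h y t) x (h1 x t)) ->
  (forall x t, is_derive (fun y => h1 y t) x (h2 x t)) ->
  (forall x t, Rabs (x - x0) <= 1 -> Rabs (h2 x t) <= C / (1 + t ^ 2)) ->
  is_derive (fun x => RInt_line (h x)) x0 (RInt_line (h1 x0)).
Proof.
  intros Hex Hex1 D1 D2 Hb. apply is_derive_Reals. intros eps Heps.
  set (K := C * cauchy_mass).
  (* The 1 keeps the increment where [h2] is bounded; the other term makes |K| |d| < eps, the added
     1 covering K = 0. *)
  assert (Hd : 0 < Rmin 1 (eps / (Rabs K + 1))).
  { apply Rmin_pos; [lra|]. apply Rdiv_lt_0_compat; auto. generalize (Rabs_pos K); lra. }
  exists (mkposreal _ Hd). simpl. intros d Hd0 Hdlt.
  assert (Hd1 : Rabs d < 1) by (eapply Rlt_le_trans; [exact Hdlt|apply Rmin_l]).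
  assert (Hd2 : Rabs d < eps / (Rabs K + 1)) by (eapply Rlt_le_trans; [exact Hdlt|apply Rmin_r]).
  assert (HI : is_RInt_line (fun t => h (x0 + d) t - h x0 t - d * h1 x0 t)
     (RInt_line (h (x0 + d)) - RInt_line (h x0) - d * RInt_line (h1 x0))).
  { refine (is_RInt_gen_minus _ _ _ _ (is_RInt_gen_minus _ _ _ _ _ _) (is_RInt_gen_scal _ d _ _));
    apply is_RInt_line_correct; auto. }
  apply (RInt_line_bound _ (C * d ^ 2)) in HI.
  - replace ((RInt_line (h (x0 + d)) - RInt_line (h x0)) / d - RInt_line (h1 x0))
      with ((RInt_line (h (x0 + d)) - RInt_line (h x0) - d * RInt_line (h1 x0)) / d) by (field; auto).
    unfold Rdiv. rewrite Rabs_mult, Rabs_inv.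
    assert (Hdp : 0 < Rabs d) by (apply Rabs_pos_lt; auto).
    apply Rle_lt_trans with (Rabs K * Rabs d).
    + apply Rmult_le_reg_r with (Rabs d); auto.
      rewrite Rmult_assoc, Rinv_l, Rmult_1_r by lra.
      eapply Rle_trans; [exact HI|].
      replace (C * d ^ 2 * cauchy_mass) with (K * d ^ 2) by (unfold K; ring).
      rewrite <- (pow2_abs d). generalize (Rle_abs K). nra.
    + assert (Hk : 0 < Rabs K + 1) by (generalize (Rabs_pos K); lra).
      apply Rle_lt_trans with ((Rabs K + 1) * Rabs d). nra.
      apply Rmult_lt_compat_l with (r := Rabs K + 1) in Hd2; auto.
      replace ((Rabs K + 1) * (eps / (Rabs K + 1))) with eps in Hd2 by (field; lra). exact Hd2.
  - intros t.
    replace (h (x0 + d) t - h x0 t - d * h1 x0 t)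
      with (h (x0 + d) t - h x0 t - h1 x0 t * (x0 + d - x0)) by ring.
    replace (C * d ^ 2 / (1 + t ^ 2)) with (C / (1 + t ^ 2) * (x0 + d - x0) ^ 2) by (field; nra).
    apply (taylor_order_1 (fun y => h y t) (fun y => h1 y t) (fun y => h2 y t)); auto.
    intros z Hz. apply Hb.
    revert Hz Hd1. unfold Rmin, Rmax, Rabs. repeat destruct Rle_dec; repeat destruct Rcase_abs; lra.
Qed.

(** * Euler's integral and Gauss' product for real arguments *)

Notation is_RInt_half f := (is_RInt_gen f (at_right 0) (Rbar_locally p_infty)).
Notation ex_RInt_half f := (ex_RInt_gen f (at_right 0) (Rbar_locally p_infty)).
Notation RInt_half f := (RInt_gen f (at_right 0) (Rbar_locally p_infty)).

Lemma filter_prod_half (P : R * R -> Prop) :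
  (forall a b, 0 < a <= 1 -> 1 <= b -> P (a, b)) ->
  filter_prod (at_right 0) (Rbar_locally p_infty) P.
Proof.
  intros H. exists (fun a => 0 < a <= 1) (fun b => 1 <= b).
  - exists (mkposreal 1 Rlt_0_1). intros y Hy Hy0. 
    apply ball_R_between in Hy; simpl in Hy. lra.
  - exists 1. intros; lra.
  - exact H.
Qed.

Lemma is_RInt_half_derive (F f : R -> R) (la lb : R) :
  (forall x, 0 < x -> is_derive F x (f x)) ->
  (forall x, 0 < x -> continuous f x) ->
  filterlim F (at_right 0) (locally la) ->
  filterlim F (Rbar_locally p_infty) (locally lb) ->
  is_RInt_half f (lb - la).
Proof.
  intros HD Hc Ha Hb.
  assert (Hloc : forall x, 0 < x -> locally x (fun y => f y = Derive F y)).
  { intros x Hx. exists (mkposreal _ Hx). intros y Hy.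
    apply ball_R_between in Hy; simpl in Hy. symmetry. apply is_derive_unique, HD. lra. }
  eapply is_RInt_gen_ext; [|apply (is_RInt_gen_Derive (Fa := at_right 0) (Fb := Rbar_locally p_infty) F la lb); auto].
  - apply filter_prod_half. simpl. intros a b H1 H2 x. rewrite Rmin_left by lra.
    intros Hx. apply is_derive_unique, HD. lra.
  - apply filter_prod_half. simpl. intros a b H1 H2 x. rewrite Rmin_left by lra.
    intros Hx. eexists; apply HD. lra.
  - apply filter_prod_half. simpl. intros a b H1 H2 x. rewrite Rmin_left by lra.
    intros Hx. apply continuous_ext_loc with f. apply Hloc; lra. apply Hc; lra.
Qed.

Lemma is_RInt_half_correct (f : R -> R) : ex_RInt_half f -> is_RInt_half f (RInt_half f).
Proof.
  intros H; apply @RInt_gen_correct; [apply Proper_StrongProper; typeclasses eauto..|exact H].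
Qed.

Lemma is_RInt_half_unique (f : R -> R) l : is_RInt_half f l -> RInt_half f = l.
Proof.
  intros H; apply @is_RInt_gen_unique; [apply Proper_StrongProper; typeclasses eauto..|exact H].
Qed.

(** The function u^p exp(-u/2) is largest at u = 2p, which is ln v <= v - 1 for v = u / (2p). The
    resulting factor exp(-p) is dropped. *)
Lemma Rpower_exp_bound (p u : R) : 0 < p -> 0 < u ->
  Rpower u p * exp (- u) <= Rpower (2 * p) p * exp (- (u / 2)).
Proof.
  intros Hp Hu. unfold Rpower. rewrite <- !exp_plus.
  assert (Hv : 0 < u / (2 * p)) by (apply Rdiv_lt_0_compat; lra).
  assert (E : ln u = ln (2 * p) + ln (u / (2 * p))).
  { rewrite <- ln_mult by lra. f_equal. field. lra. }
  assert (Hln : ln (u / (2 * p)) <= u / (2 * p) - 1).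
  { generalize (exp_ineq1_le (ln (u / (2 * p)))). rewrite exp_ln by auto. lra. }
  rewrite E.
  assert (H : p * ln (u / (2 * p)) <= u / 2 - p).
  { apply Rle_trans with (p * (u / (2 * p) - 1)).
    - apply Rmult_le_compat_l; lra.
    - right. field. lra. }
  destruct (Req_dec (p * (ln (2 * p) + ln (u / (2 * p))) + - u) (p * ln (2 * p) + - (u / 2))) as [->|Hne].
  - lra.
  - left. apply exp_increasing. nra.
Qed.

(** The integrand u^(a-1) exp(-u) du of Euler's integral, written at u = mu y. *)
Definition euler_weight (a mu y : R) : R :=
  Rpower (mu * y) (a - 1) * exp (- (mu * y)) * mu.

Definition euler_int (a mu : R) : R := RInt_half (euler_weight a mu).

Lemma Rpower_pred (u a : R) : 0 < u -> u * Rpower u (a - 1) = Rpower u a.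
Proof.
  intros Hu. rewrite <- (Rpower_1 u Hu) at 1. rewrite <- Rpower_plus. f_equal. ring.
Qed.

(** Integration by parts in differential form; it gives both the recurrence and, for small [a], the
    convergence at 0. *)
Lemma is_derive_euler_boundary (a mu y : R) : 0 < mu -> 0 < y ->
  is_derive (fun y => Rpower (mu * y) a * exp (- (mu * y))) y
    (a * euler_weight a mu y - euler_weight (a + 1) mu y).
Proof.
  intros Hmu Hy. assert (Hu : 0 < mu * y) by nra.
  unfold euler_weight. replace (a + 1 - 1) with a by ring.
  evar_last.
  - unfold Rpower. auto_derive. exact Hu. reflexivity.
  - simpl. rewrite <- (Rpower_pred (mu * y) a Hu).
    change (exp (a * ln (mu * y))) with (Rpower (mu * y) a).
    rewrite <- (Rpower_pred (mu * y) a Hu). field. nra.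
Qed.

Lemma continuous_euler_weight (a mu y : R) : 0 < mu -> 0 < y ->
  continuous (euler_weight a mu) y.
Proof.
  intros Hmu Hy. apply @ex_derive_continuous. unfold euler_weight, Rpower.
  auto_derive. nra.
Qed.

Lemma euler_weight_pos (a mu y : R) : 0 < mu -> 0 <= euler_weight a mu y.
Proof.
  intros Hmu. unfold euler_weight, Rpower.
  generalize (exp_pos ((a - 1) * ln (mu * y))) (exp_pos (- (mu * y))). intros.
  apply Rmult_le_pos; [apply Rmult_le_pos|]; lra.
Qed.

(** For a < 1 the weight is unbounded near 0. Integration by parts trades it for the weight of
    exponent a, which is at most C mu exp(-mu y / 2) with integral at most 2C. The boundary term at
    [M] adds at most C and the one at [e] is subtracted, whence 3C / a. *)
Lemma ex_RInt_half_euler (a mu : R) : 0 < a -> 0 < mu ->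
  ex_RInt_half (euler_weight a mu).
Proof.
  intros Ha Hmu. set (C := Rpower (2 * a) a).
  apply (ex_RInt_gen_nonneg_bounded _ _ (fun x => 0 < x <= 1) (fun x => 1 <= x) _ (3 * C / a)).
  - exists (mkposreal 1 Rlt_0_1). intros y Hy Hy0. 
    apply ball_R_between in Hy; simpl in Hy. lra.
  - exists 1; intros; lra.
  - intros x [Hx _]. exists (mkposreal x Hx). intros y Hy Hy0.
    apply ball_R_between in Hy; simpl in Hy. lra.
  - intros x _; exists x; intros; lra.
  - intros e M He HM.
    assert (Hex : forall a, ex_RInt (euler_weight a mu) e M).
    { intros b. apply (ex_RInt_continuous (V := R_CompleteNormedModule)).
      intros z. rewrite Rmin_left by lra. intros; apply continuous_euler_weight; lra. }
    repeat split; auto; try lra.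
    2: intros; apply euler_weight_pos; auto.
    assert (I1 : is_RInt (fun y => a * euler_weight a mu y - euler_weight (a + 1) mu y) e M
       (Rpower (mu * M) a * exp (- (mu * M)) - Rpower (mu * e) a * exp (- (mu * e)))).
    { apply (is_RInt_derive (fun y => Rpower (mu * y) a * exp (- (mu * y)))).
      - intros x. rewrite Rmin_left by lra. intros; apply is_derive_euler_boundary; lra.
      - intros x. rewrite Rmin_left by lra. intros.
        apply (continuous_minus (V := R_NormedModule)).
        apply (continuous_scal_r (V := R_NormedModule)).
        all: apply continuous_euler_weight; lra. }
    assert (I2 : is_RInt (fun y => a * euler_weight a mu y - euler_weight (a + 1) mu y) e M
       (a * RInt (euler_weight a mu) e M - RInt (euler_weight (a + 1) mu) e M)).
    { apply (is_RInt_minus (V := R_NormedModule)).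
      apply (is_RInt_scal (V := R_NormedModule)).
      all: apply (RInt_correct (V := R_CompleteNormedModule)); auto. }
    apply (is_RInt_unique (V := R_CompleteNormedModule)) in I1.
    apply (is_RInt_unique (V := R_CompleteNormedModule)) in I2.
    rewrite I1 in I2.
    assert (I3 : is_RInt (fun y => C * exp (- (mu * y / 2)) * mu) e M
      (- (2 * C * exp (- (mu * M / 2))) - - (2 * C * exp (- (mu * e / 2))))).
    { apply (is_RInt_derive (fun y => - (2 * C * exp (- (mu * y / 2))))).
      - intros x _. auto_derive; auto. unfold Rdiv. field.
      - intros x _. apply @ex_derive_continuous. auto_derive; auto. }
    assert (L : RInt (euler_weight (a + 1) mu) e M <= RInt (fun y => C * exp (- (mu * y / 2)) * mu) e M).
    { apply RInt_le; auto; try lra. eexists; exact I3.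
      intros x Hx. unfold euler_weight. replace (a + 1 - 1) with a by ring.
      apply Rmult_le_compat_r; [lra|]. apply Rpower_exp_bound; nra. }
    rewrite (is_RInt_unique _ _ _ _ I3) in L.
    assert (HC : 0 < C) by apply exp_pos.
    assert (HuM : 0 < mu * M) by nra.
    generalize (Rpower_exp_bound a (mu * M) Ha HuM). fold C.
    assert (E1 : forall x, 0 <= x -> 0 < exp (- (x / 2)) <= 1).
    { intros x Hx. split. apply exp_pos. rewrite <- exp_0.
      destruct Hx as [Hx| <-]. left; apply exp_increasing; lra. right; f_equal; field. }
    assert (P1 : 0 < Rpower (mu * e) a * exp (- (mu * e)))
      by (apply Rmult_lt_0_compat; apply exp_pos).
    assert (Hue : 0 <= mu * e) by nra.
    generalize (E1 (mu * M) (Rlt_le _ _ HuM)) (E1 (mu * e) Hue). intros.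
    apply Rmult_le_reg_l with a; auto.
    replace (a * (3 * C / a)) with (3 * C) by (field; lra). nra.
Qed.

Lemma euler_boundary_0 (a mu : R) : 0 < a -> 0 < mu ->
  filterlim (fun y => Rpower (mu * y) a * exp (- (mu * y))) (at_right 0) (locally 0).
Proof.
  intros Ha Hmu. apply filterlim_locally. intros eps.
  assert (Hd : 0 < Rpower eps (/ a) / mu) by (apply Rdiv_lt_0_compat; auto; apply exp_pos).
  exists (mkposreal _ Hd). intros y Hy Hy0.
  unfold ball in *; simpl in *; unfold AbsRing_ball, abs, minus, plus, opp in *; simpl in *.
  apply Rabs_def2 in Hy. destruct Hy as [Hy _].
  assert (Hu : 0 < mu * y) by nra.
  assert (Hlt : mu * y < Rpower eps (/ a)).
  { apply Rmult_lt_compat_l with (r := mu) in Hy; auto.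
    replace (mu * (Rpower eps (/ a) / mu)) with (Rpower eps (/ a)) in Hy by (field; lra). lra. }
  assert (H1 : Rpower (mu * y) a < eps).
  { apply Rlt_le_trans with (Rpower (Rpower eps (/ a)) a).
    - apply Rlt_Rpower_l; lra.
    - rewrite Rpower_mult, Rinv_l, Rpower_1 by (try lra; apply cond_pos). lra. }
  assert (H2 : 0 < exp (- (mu * y)) < 1).
  { split. apply exp_pos. rewrite <- exp_0. apply exp_increasing. lra. }
  assert (H3 : 0 < Rpower (mu * y) a) by apply exp_pos.
  apply Rabs_def1; nra.
Qed.

Lemma exp_decay_p_infty (C mu : R) : 0 < C -> 0 < mu ->
  filterlim (fun y => C * exp (- (mu * y))) (Rbar_locally p_infty) (locally 0).
Proof.
  intros HC Hmu. apply filterlim_locally. intros eps.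
  exists (C / (mu * eps)). intros y Hy.
  unfold ball in *; simpl in *; unfold AbsRing_ball, abs, minus, plus, opp in *; simpl in *.
  assert (Hep := cond_pos eps).
  assert (He : 0 < mu * eps) by (apply Rmult_lt_0_compat; auto).
  assert (H1 : C < eps * (mu * y)).
  { apply Rmult_lt_compat_l with (r := mu * eps) in Hy; auto.
    replace (mu * eps * (C / (mu * eps))) with C in Hy by (field; split; lra). lra. }
  assert (Hu : 0 < mu * y) by nra.
  generalize (exp_ineq1_le (mu * y)) (exp_pos (- (mu * y))) (exp_pos (mu * y)). intros.
  assert (E : exp (mu * y) * exp (- (mu * y)) = 1)
    by (rewrite <- exp_plus, Rplus_opp_r, exp_0; auto).
  assert (C * exp (- (mu * y)) < eps).
  { apply Rmult_lt_reg_l with (exp (mu * y)); auto.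
    replace (exp (mu * y) * (C * exp (- (mu * y)))) with C by (rewrite <- (Rmult_1_r C) at 1; rewrite <- E; ring).
    nra. }
  apply Rabs_def1; nra.
Qed.

Lemma euler_boundary_p_infty (a mu : R) : 0 < a -> 0 < mu ->
  filterlim (fun y => Rpower (mu * y) a * exp (- (mu * y))) (Rbar_locally p_infty) (locally 0).
Proof.
  intros Ha Hmu.
  apply (filterlim_le_le (fun _ => 0) _ (fun y => Rpower (2 * a) a * exp (- (mu / 2 * y))) 0).
  - exists 0. intros y Hy. split.
    + apply Rmult_le_pos; left; apply exp_pos.
    + replace (mu / 2 * y) with (mu * y / 2) by field. apply Rpower_exp_bound; nra.
  - apply filterlim_const.
  - apply exp_decay_p_infty. apply exp_pos. lra.
Qed.

Lemma euler_int_succ (a mu : R) : 0 < a -> 0 < mu ->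
  euler_int (a + 1) mu = a * euler_int a mu.
Proof.
  intros Ha Hmu.
  assert (I1 : is_RInt_half (fun y => a * euler_weight a mu y - euler_weight (a + 1) mu y) (0 - 0)).
  { apply (is_RInt_half_derive (fun y => Rpower (mu * y) a * exp (- (mu * y)))).
    - intros; apply is_derive_euler_boundary; auto.
    - intros. apply (continuous_minus (V := R_NormedModule)).
      apply (continuous_scal_r (V := R_NormedModule)).
      all: apply continuous_euler_weight; lra.
    - apply euler_boundary_0; auto.
    - apply euler_boundary_p_infty; auto. }
  assert (I2 : is_RInt_half (fun y => a * euler_weight a mu y - euler_weight (a + 1) mu y)
     (a * euler_int a mu - euler_int (a + 1) mu)).
  { apply (is_RInt_gen_minus (V := R_NormedModule)).
    apply (is_RInt_gen_scal (V := R_NormedModule)).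
    all: apply is_RInt_half_correct, ex_RInt_half_euler; lra. }
  apply is_RInt_half_unique in I1. apply is_RInt_half_unique in I2. lra.
Qed.

Lemma euler_int_1 (mu : R) : 0 < mu -> euler_int 1 mu = 1.
Proof.
  intros Hmu.
  assert (I : is_RInt_half (euler_weight 1 mu) (0 - - (1))).
  { apply (is_RInt_half_derive (fun y => - (1 * exp (- (mu * y)))) (euler_weight 1 mu)).
    - intros x Hx. unfold euler_weight. rewrite Rminus_diag, Rpower_O by nra. auto_derive; auto; ring.
    - intros; apply continuous_euler_weight; auto.
    - apply (filterlim_filter_le_1 (F := locally 0)).
      + intros P [d Hd]. exists d. intros y Hy _. apply Hd, Hy.
      + evar_last.
        * apply (@ex_derive_continuous R_AbsRing R_NormedModule (fun y => - (1 * exp (- (mu * y)))) 0).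
          auto_derive; auto.
        * simpl. rewrite Rmult_0_r, Ropp_0, exp_0. f_equal; ring.
    - rewrite <- Ropp_0.
      apply (filterlim_comp _ _ _ (fun y => 1 * exp (- (mu * y))) Ropp _ (locally 0)).
      + apply exp_decay_p_infty; lra.
      + apply (filterlim_opp (V := R_NormedModule)). }
  apply is_RInt_half_unique in I. unfold euler_int. lra.
Qed.

Lemma euler_int_fact (n : nat) (mu : R) : 0 < mu -> euler_int (INR n + 1) mu = INR (fact n).
Proof.
  intros Hmu. induction n.
  - simpl. rewrite Rplus_0_l. apply euler_int_1; auto.
  - rewrite S_INR, euler_int_succ, IHn by (auto; generalize (pos_INR n); lra).
    rewrite fact_simpl, mult_INR, S_INR. ring.
Qed.

(* Weighted AM-GM, from the tangent to [exp] at [a * L]. *)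
Lemma exp_convex_0 (a L : R) : 0 <= a <= 1 -> exp (a * L) <= 1 - a + a * exp L.
Proof.
  intros Ha.
  assert (H1 : exp L = exp (a * L) * exp ((1 - a) * L)) by (rewrite <- exp_plus; f_equal; ring).
  assert (H2 : 1 = exp (a * L) * exp (- (a * L))) by (rewrite <- exp_plus, Rplus_opp_r, exp_0; auto).
  generalize (exp_ineq1_le ((1 - a) * L)) (exp_ineq1_le (- (a * L))) (exp_pos (a * L)).
  set (E := exp (a * L)) in *. intros A1 A2 HE.
  assert (E * (1 + (1 - a) * L) <= exp L) by (rewrite H1; apply Rmult_le_compat_l; lra).
  assert (E * (1 + - (a * L)) <= 1) by (rewrite H2; apply Rmult_le_compat_l; lra).
  nra.
Qed.

(** This replaces log-convexity and Hölder's inequality. With u = mu y, the pointwise bound u^a <=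
    x^a (1 - a + a u / x) is integrated against the weight of parameter x; since I(x+1) = x I(x),
    the right side integrates to exactly x^a I(x). *)
Lemma euler_int_shift_le (x a mu : R) : 0 < x -> 0 <= a <= 1 -> 0 < mu ->
  euler_int (x + a) mu <= Rpower x a * euler_int x mu.
Proof.
  intros Hx Ha Hmu.
  replace (Rpower x a * euler_int x mu)
    with (Rpower x a * (1 - a) * euler_int x mu + Rpower x a * (a / x) * euler_int (x + 1) mu)
    by (rewrite euler_int_succ by auto; field; lra).
  eapply Rle_trans; [apply Rle_abs|].
  apply (RInt_gen_norm (V := R_CompleteNormedModule) (Fa := at_right 0) (Fb := Rbar_locally p_infty)
    (euler_weight (x + a) mu)
    (fun y => Rpower x a * (1 - a) * euler_weight x mu y + Rpower x a * (a / x) * euler_weight (x + 1) mu y)).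
  - apply filter_prod_half. simpl; intros; lra.
  - apply filter_prod_half. simpl. intros e M He HM y Hy.
    unfold norm; simpl; unfold abs; simpl. rewrite Rabs_pos_eq by (apply euler_weight_pos; auto).
    assert (Hu : 0 < mu * y) by nra.
    unfold euler_weight. replace (x + a - 1) with (a + (x - 1)) by ring.
    replace (x + 1 - 1) with x by ring.
    rewrite Rpower_plus. rewrite <- (Rpower_pred (mu * y) x Hu).
    assert (HT : Rpower (mu * y) a <= Rpower x a * (1 - a) + Rpower x a * (a / x) * (mu * y)).
    { assert (Hv : 0 < mu * y / x) by (apply Rdiv_lt_0_compat; lra).
      generalize (exp_convex_0 a (ln (mu * y / x)) Ha). rewrite exp_ln by auto. intros H.
      replace (Rpower (mu * y) a) with (Rpower x a * exp (a * ln (mu * y / x))).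
      - replace (Rpower x a * (1 - a) + Rpower x a * (a / x) * (mu * y))
          with (Rpower x a * (1 - a + a * (mu * y / x))) by (field; lra).
        apply Rmult_le_compat_l; auto. left; apply exp_pos.
      - symmetry. change (Rpower (mu * y) a = Rpower x a * Rpower (mu * y / x) a).
        rewrite Rpower_mult_distr by auto. f_equal. field. lra. }
    assert (H1 : 0 < Rpower (mu * y) (x - 1)) by apply exp_pos.
    assert (H2 := exp_pos (- (mu * y))).
    replace (Rpower x a * (1 - a) * (Rpower (mu * y) (x - 1) * exp (- (mu * y)) * mu) +
      Rpower x a * (a / x) * (mu * y * Rpower (mu * y) (x - 1) * exp (- (mu * y)) * mu))
      with ((Rpower x a * (1 - a) + Rpower x a * (a / x) * (mu * y)) *
            (Rpower (mu * y) (x - 1) * exp (- (mu * y)) * mu)) by ring.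
    replace (Rpower (mu * y) a * Rpower (mu * y) (x - 1) * exp (- (mu * y)) * mu)
      with (Rpower (mu * y) a * (Rpower (mu * y) (x - 1) * exp (- (mu * y)) * mu)) by ring.
    apply Rmult_le_compat_r; auto. left. repeat apply Rmult_lt_0_compat; auto.
  - apply is_RInt_half_correct, ex_RInt_half_euler; lra.
  - apply (is_RInt_gen_plus (V := R_NormedModule));
    apply (is_RInt_gen_scal (V := R_NormedModule));
    apply is_RInt_half_correct, ex_RInt_half_euler; lra.
Qed.

(** * Real Gauss product, with n + 1 factors a (a+1) ... (a+n), and its Bohr-Mollerup squeeze *)

Fixpoint rising (a : R) (n : nat) : R :=
  match n with
  | O => a
  | S p => rising a p * (a + INR (S p))
  end.

Definition gauss_real (a : R) (n : nat) : R := INR (fact n) * Rpower (INR n) a / rising a n.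

Lemma rising_pos (a : R) (n : nat) : 0 < a -> 0 < rising a n.
Proof.
  intros Ha. induction n; simpl; auto. apply Rmult_lt_0_compat; auto.
  generalize (pos_INR (S n)). simpl. lra.
Qed.

Lemma rising_succ (a : R) (n : nat) : a * rising (a + 1) n = rising a n * (a + INR n + 1).
Proof.
  induction n.
  - simpl; ring.
  - cbn [rising]. rewrite <- Rmult_assoc, IHn, S_INR. ring.
Qed.

Lemma euler_int_rising (a mu : R) (n : nat) : 0 < a -> 0 < mu ->
  euler_int (a + INR n + 1) mu = rising a n * euler_int a mu.
Proof.
  intros Ha Hmu. induction n.
  - simpl. rewrite Rplus_0_r. apply euler_int_succ; auto.
  - rewrite S_INR. cbn [rising].
    replace (a + (INR n + 1) + 1) with (a + INR n + 1 + 1) by ring.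
    rewrite euler_int_succ, IHn, S_INR by (auto; generalize (pos_INR n); lra). ring.
Qed.

Lemma is_lim_seq_inv_INR (b : R) : is_lim_seq (fun n => / (INR n + b)) 0.
Proof.
  apply (is_lim_seq_inv _ p_infty); [|discriminate].
  eapply is_lim_seq_plus. apply is_lim_seq_INR. apply is_lim_seq_const. reflexivity.
Qed.

(** With N = n + 1, the shift inequality is used from N to N + a and from N + a to N + 1, where I(N)
    = n!, I(N+1) = N n! and I(N+a) = a (a+1) ... (a+n) I(a). Replacing N^a and (N+a)^a by n^a leaves
    the factors n / N = 1 - 1/N below and (N+a) / N <= 1 + 1/N above. *)
Lemma gauss_real_bounds (a mu : R) (n : nat) : 0 < a <= 1 -> 0 < mu -> (1 <= n)%nat ->
  euler_int a mu * (1 - / (INR n + 1)) <= gauss_real a n <= euler_int a mu * (1 + / (INR n + 1)).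
Proof.
  intros Ha Hmu Hn. apply le_INR in Hn. simpl in Hn.
  set (N := INR n + 1). set (f := euler_int a mu). set (p := rising a n).
  assert (Hp : 0 < p) by (apply rising_pos; lra).
  assert (Hf : euler_int (N + a) mu = p * f).
  { unfold N, p, f. rewrite <- euler_int_rising by lra. f_equal; ring. }
  assert (U : p * f <= Rpower N a * INR (fact n)).
  { rewrite <- Hf. rewrite <- (euler_int_fact n mu Hmu). apply euler_int_shift_le; unfold N; lra. }
  assert (L : N * INR (fact n) <= Rpower (N + a) (1 - a) * (p * f)).
  { rewrite <- Hf. replace (N * INR (fact n)) with (euler_int (N + a + (1 - a)) mu).
    - apply euler_int_shift_le; unfold N; lra.
    - replace (N + a + (1 - a)) with (INR (S n) + 1) by (unfold N; rewrite S_INR; ring).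
      rewrite euler_int_fact, fact_simpl, mult_INR, S_INR; auto. }
  assert (Hna : 0 < Rpower (INR n) a) by apply exp_pos.
  assert (Hfact : 0 < INR (fact n)) by apply INR_fact_lt_0.
  unfold gauss_real. fold p.
  (* Since N / n >= 1 and a <= 1, (N/n)^a <= N/n. *)
  assert (Hratio : Rpower N a * INR n <= Rpower (INR n) a * N).
  { replace (Rpower N a) with (Rpower (INR n) a * Rpower (N / INR n) a).
    - assert (Hr : Rpower (N / INR n) a <= N / INR n).
      { rewrite <- (Rpower_1 (N / INR n)) at 2 by (apply Rdiv_lt_0_compat; unfold N; lra).
        apply Rle_Rpower; [|lra]. apply Rmult_le_reg_r with (INR n); [lra|].
        unfold Rdiv. rewrite Rmult_assoc, Rinv_l by lra. unfold N; lra. }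
      apply Rmult_le_compat_r with (r := INR n) in Hr; [|lra].
      replace (N / INR n * INR n) with N in Hr by (field; lra).
      rewrite Rmult_assoc. apply Rmult_le_compat_l; lra.
    - rewrite Rpower_mult_distr by (try apply Rdiv_lt_0_compat; unfold N; lra). f_equal. field. lra. }
  assert (HN : 0 < N) by (unfold N; lra).
  assert (Hprod : Rpower (N + a) (1 - a) * Rpower (INR n) a <= N + a).
  { replace (N + a) with (Rpower (N + a) (1 - a) * Rpower (N + a) a) at 2.
    - apply Rmult_le_compat_l. left; apply exp_pos. apply Rle_Rpower_l; unfold N; lra.
    - rewrite <- Rpower_plus. replace (1 - a + a) with 1 by ring. apply Rpower_1. lra. }
  (* The left side of [L] is positive, so I(a) cannot be <= 0. *)
  assert (Hf0 : 0 < f).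
  { assert (0 < Rpower (N + a) (1 - a)) by apply exp_pos.
    assert (0 < N * INR (fact n)) by nra.
    apply Rnot_le_lt. intros Hneg. assert (p * f <= 0) by nra. nra. }
  split.
  - apply Rmult_le_reg_r with (p * N); [nra|].
    replace (f * (1 - / N) * (p * N)) with (p * f * INR n) by (unfold N; field; unfold N in HN; lra).
    replace (INR (fact n) * Rpower (INR n) a / p * (p * N)) with (INR (fact n) * (Rpower (INR n) a * N)) by (field; lra).
    apply Rle_trans with (Rpower N a * INR (fact n) * INR n). nra.
    replace (Rpower N a * INR (fact n) * INR n) with (INR (fact n) * (Rpower N a * INR n)) by ring.
    apply Rmult_le_compat_l; lra.
  - apply Rmult_le_reg_r with (p * N); [nra|].
    replace (f * (1 + / N) * (p * N)) with (p * f * (N + 1)) by (field; lra).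
    replace (INR (fact n) * Rpower (INR n) a / p * (p * N)) with (N * INR (fact n) * Rpower (INR n) a) by (field; lra).
    apply Rle_trans with (Rpower (N + a) (1 - a) * (p * f) * Rpower (INR n) a).
    + apply Rmult_le_compat_r; lra.
    + replace (Rpower (N + a) (1 - a) * (p * f) * Rpower (INR n) a)
        with (p * f * (Rpower (N + a) (1 - a) * Rpower (INR n) a)) by ring.
      apply Rmult_le_compat_l; [nra|lra].
Qed.

Lemma gauss_real_lim_le_1 (a mu : R) : 0 < a <= 1 -> 0 < mu ->
  is_lim_seq (gauss_real a) (euler_int a mu).
Proof.
  intros Ha Hmu.
  apply is_lim_seq_le_le_loc with
    (fun n => euler_int a mu * (1 - / (INR n + 1))) (fun n => euler_int a mu * (1 + / (INR n + 1))).
  - exists 1%nat. intros n Hn. apply gauss_real_bounds; auto.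
  - replace (Finite (euler_int a mu)) with (Rbar_mult (euler_int a mu) (1 - 0)) by (simpl; f_equal; ring).
    apply is_lim_seq_scal_l. apply is_lim_seq_minus'. apply is_lim_seq_const. apply is_lim_seq_inv_INR.
  - replace (Finite (euler_int a mu)) with (Rbar_mult (euler_int a mu) (1 + 0)) by (simpl; f_equal; ring).
    apply is_lim_seq_scal_l. apply is_lim_seq_plus'. apply is_lim_seq_const. apply is_lim_seq_inv_INR.
Qed.

(** The quotient is a n / (n + a + 1), written so that its limit a can be read off. *)
Lemma gauss_real_succ (a : R) (n : nat) : 0 < a -> (1 <= n)%nat ->
  gauss_real (a + 1) n = gauss_real a n * (a * (1 - (a + 1) * / (INR n + (a + 1)))).
Proof.
  intros Ha Hn. apply le_INR in Hn. simpl in Hn. unfold gauss_real.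
  rewrite Rpower_plus, Rpower_1 by lra.
  generalize (rising_succ a n) (rising_pos a n Ha). intros E Hp.
  assert (Hp1 : 0 < rising (a + 1) n) by (apply rising_pos; lra).
  replace (rising a n) with (a * rising (a + 1) n / (a + INR n + 1)) by (rewrite E; field; lra).
  field. repeat split; lra.
Qed.

(** The squeeze covers a <= 1; larger arguments follow by induction, since both sides satisfy the
    same recurrence in a. *)
Lemma gauss_real_lim (a mu : R) : 0 < a -> 0 < mu ->
  is_lim_seq (gauss_real a) (euler_int a mu) /\ 0 < euler_int a mu.
Proof.
  intros Ha Hmu.
  assert (H : forall n a, 0 < a <= INR n + 1 -> 
    is_lim_seq (gauss_real a) (euler_int a mu) /\ 0 < euler_int a mu).
  { clear a Ha. induction n; intros a Ha.
    - simpl in Ha. split. apply gauss_real_lim_le_1; lra.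
      (* Here 1 = I(1) <= a^(1-a) I(a), which forces I(a) > 0. *)
      assert (H : euler_int (a + (1 - a)) mu <= Rpower a (1 - a) * euler_int a mu)
        by (apply euler_int_shift_le; lra).
      replace (a + (1 - a)) with 1 in H by ring. rewrite euler_int_1 in H by auto.
      assert (0 < Rpower a (1 - a)) by apply exp_pos. nra.
    - destruct (Rle_dec a 1) as [H1|H1].
      { apply IHn. generalize (pos_INR n). lra. }
      rewrite S_INR in Ha.
      destruct (IHn (a - 1)) as [L P]; [lra|].
      replace a with (a - 1 + 1) by ring. rewrite euler_int_succ by lra. split.
      + replace ((a - 1) * euler_int (a - 1) mu)
          with (euler_int (a - 1) mu * ((a - 1) * (1 - (a - 1 + 1) * 0))) by ring.
        apply is_lim_seq_ext_loc with
          (fun n => gauss_real (a - 1) n * ((a - 1) * (1 - (a - 1 + 1) * / (INR n + (a - 1 + 1))))).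
        * exists 1%nat. intros m Hm. symmetry. apply gauss_real_succ; auto; lra.
        * apply is_lim_seq_mult'; auto. apply is_lim_seq_mult'. apply is_lim_seq_const.
          apply is_lim_seq_minus'. apply is_lim_seq_const. apply is_lim_seq_mult'.
          apply is_lim_seq_const. apply is_lim_seq_inv_INR.
      + nra. }
  destruct (INR_unbounded a) as [n Hn]. apply (H n). lra.
Qed.

(** * Gauss' product for complex arguments *)

Open Scope C_scope.

Definition rising_C (s : C) (n : nat) : C := Cprod (map (fun k => s + INR k) (seq 0 (S n))).

Lemma gauss_seq_eq (s : C) (n : nat) :
  gauss_seq s n = INR (fact n) * cpowR (INR n) s / rising_C s n.
Proof. reflexivity. Qed.

Lemma Cprod_snoc (l : list C) (z : C) : Cprod (l ++ [z]) = Cprod l * z.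
Proof. induction l as [|x l IH]; simpl; [|rewrite IH]; ring. Qed.

Lemma rising_C_0 (s : C) : rising_C s 0 = s.
Proof. unfold rising_C; simpl. ring. Qed.

Lemma rising_C_S (s : C) (n : nat) : rising_C s (S n) = rising_C s n * (s + INR (S n)).
Proof.
  unfold rising_C. rewrite seq_S, map_app. cbn [map]. now rewrite Cprod_snoc.
Qed.

Lemma rising_C_R (a : R) (n : nat) : rising_C a n = rising a n.
Proof.
  induction n. apply rising_C_0.
  rewrite rising_C_S, IHn. cbn [rising]. now rewrite RtoC_mult, RtoC_plus.
Qed.

Lemma rising_C_shift (s : C) (n : nat) : s * rising_C (s + 1) n = rising_C s n * (s + INR n + 1).
Proof.
  induction n.
  - rewrite !rising_C_0. simpl. ring.
  - rewrite !rising_C_S, Cmult_assoc, IHn, !S_INR, !RtoC_plus. ring.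
Qed.

Lemma RtoC_plus_nonzero (s : C) (x : R) : (0 < fst s + x)%R -> s + x <> 0.
Proof. intros H E. apply (f_equal fst) in E. simpl in E. lra. Qed.

Lemma rising_C_nonzero (s : C) (n : nat) : (0 < fst s)%R -> rising_C s n <> 0.
Proof.
  intros Hs. induction n.
  - rewrite rising_C_0. intros E. apply (f_equal fst) in E. simpl in E. lra.
  - rewrite rising_C_S. apply Cmult_neq_0; auto. apply RtoC_plus_nonzero.
    generalize (pos_INR (S n)). lra.
Qed.

(** * Two-sided bounds for the modulus of Gauss' sequence *)

Lemma fst_le_Cmod (z : C) : (fst z <= Cmod z)%R.
Proof. eapply Rle_trans; [apply Rle_abs|apply re_le_Cmod]. Qed.

Lemma Cmod_le_abs (z : C) : (Cmod z <= Rabs (fst z) + Rabs (snd z))%R.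
Proof.
  apply Rsqr_incr_0_var.
  - unfold Rsqr. replace (Cmod z * Cmod z)%R with (Cmod z ^ 2)%R by ring. rewrite Cmod2_alt.
    unfold Re, Im. rewrite <- (pow2_abs (fst z)), <- (pow2_abs (snd z)).
    generalize (Rabs_pos (fst z)) (Rabs_pos (snd z)). nra.
  - generalize (Rabs_pos (fst z)) (Rabs_pos (snd z)). lra.
Qed.

(** With q = (Im z / Re z)^2, |z| = Re z sqrt(1+q) <= Re z (1+q) <= Re z exp(q). The exponential
    turns the product over the factors into a sum of exponents. *)
Lemma Cmod_le_exp (z : C) : (0 < fst z)%R ->
  (Cmod z <= fst z * exp ((snd z / fst z) ^ 2))%R.
Proof.
  intros Hz. set (x := ((snd z / fst z) ^ 2)%R).
  assert (Hx : (0 <= x)%R) by (apply pow2_ge_0).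
  apply Rle_trans with (fst z * (1 + x))%R.
  - apply Rsqr_incr_0_var; [|nra].
    unfold Rsqr. replace (Cmod z * Cmod z)%R with (Cmod z ^ 2)%R by ring. rewrite Cmod2_alt.
    unfold Re, Im. replace (snd z ^ 2)%R with (fst z ^ 2 * x)%R by (unfold x; field; lra).
    assert (0 <= fst z ^ 2)%R by apply pow2_ge_0. nra.
  - apply Rmult_le_compat_l; [lra|]. apply exp_ineq1_le.
Qed.

Lemma rising_C_lower (s : C) (n : nat) : (0 < fst s)%R ->
  (rising (fst s) n <= Cmod (rising_C s n))%R.
Proof.
  intros Hs. induction n.
  - rewrite rising_C_0. apply fst_le_Cmod.
  - rewrite rising_C_S, Cmod_mult. cbn [rising].
    apply Rmult_le_compat; auto.
    + left; apply rising_pos; auto.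
    + generalize (pos_INR (S n)). lra.
    + replace (fst s + INR (S n))%R with (fst (s + INR (S n))) by reflexivity. apply fst_le_Cmod.
Qed.

Lemma exp_le (x y : R) : (x <= y)%R -> (exp x <= exp y)%R.
Proof. intros [H| ->]; [left; apply exp_increasing; auto|lra]. Qed.

(** The exponent dominates the sum of t^2 / (x+j)^2 for j = 0, ..., n. The terms with j >= 1
    telescope through 1/(y+1)^2 <= 1/y - 1/(y+1), and keeping -1/(x+n) is what lets the induction
    close. *)
Lemma rising_C_upper (s : C) (n : nat) : (0 < fst s)%R ->
  (Cmod (rising_C s n) <=
   rising (fst s) n * exp ((snd s / fst s) ^ 2 + snd s ^ 2 * (/ fst s - / (fst s + INR n))))%R.
Proof.
  intros Hs. induction n.
  - rewrite rising_C_0. simpl INR. rewrite Rplus_0_r, Rminus_diag, Rmult_0_r, Rplus_0_r.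
    apply Cmod_le_exp; auto.
  - rewrite rising_C_S, Cmod_mult. cbn [rising].
    set (x := fst s) in *. set (t := snd s) in *.
    assert (Hn := pos_INR n).
    apply Rle_trans with (rising x n * exp ((t / x) ^ 2 + t ^ 2 * (/ x - / (x + INR n))) *
       ((x + INR (S n)) * exp ((t / (x + INR (S n))) ^ 2)))%R.
    + apply Rmult_le_compat; auto using Cmod_ge_0.
      assert (H := Cmod_le_exp (s + INR (S n))).
      change (fst (s + INR (S n))) with (x + INR (S n))%R in H.
      change (snd (s + INR (S n))) with (t + 0)%R in H. rewrite Rplus_0_r in H.
      apply H. generalize (pos_INR (S n)). lra.
    + rewrite S_INR.
      replace (rising x n * exp ((t / x) ^ 2 + t ^ 2 * (/ x - / (x + INR n))) *
         ((x + (INR n + 1)) * exp ((t / (x + (INR n + 1))) ^ 2)))%R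
       with (rising x n * (x + (INR n + 1)) * (exp ((t / x) ^ 2 + t ^ 2 * (/ x - / (x + INR n)))
          * exp ((t / (x + (INR n + 1))) ^ 2)))%R by ring.
      apply Rmult_le_compat_l.
      { apply Rmult_le_pos. left; apply rising_pos; auto. lra. }
      rewrite <- exp_plus.
      assert (Hle : ((t / x) ^ 2 + t ^ 2 * (/ x - / (x + INR n)) + (t / (x + (INR n + 1))) ^ 2 <=
        (t / x) ^ 2 + t ^ 2 * (/ x - / (x + (INR n + 1))))%R).
      { set (y := (x + INR n)%R). replace (x + (INR n + 1))%R with (y + 1)%R by (unfold y; ring).
        assert (Hy : (0 < y)%R) by (unfold y; lra).
        assert (H : ((t / (y + 1)) ^ 2 <= t ^ 2 * (/ y - / (y + 1)))%R).
        { replace ((t / (y + 1)) ^ 2)%R with (t ^ 2 * (/ (y + 1) * / (y + 1)))%R by (field; lra).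
          replace (/ y - / (y + 1))%R with (/ y * / (y + 1))%R by (field; lra).
          apply Rmult_le_compat_l. apply pow2_ge_0.
          apply Rmult_le_compat_r. left; apply Rinv_0_lt_compat; lra.
          apply Rinv_le_contravar; lra. }
        lra. }
      apply exp_le, Hle.
Qed.

Lemma Cmod_cpowR (z : R) (s : C) : Cmod (cpowR z s) = exp (fst s * ln z).
Proof.
  unfold Cmod, cpowR. simpl fst. simpl snd.
  replace ((exp (fst s * ln z) * cos (snd s * ln z)) ^ 2 + (exp (fst s * ln z) * sin (snd s * ln z)) ^ 2)%R
    with (exp (fst s * ln z) ^ 2)%R.
  - apply sqrt_pow2. left; apply exp_pos.
  - generalize (sin2_cos2 (snd s * ln z)). unfold Rsqr. intros H.
    replace (exp (fst s * ln z) ^ 2)%R with (exp (fst s * ln z) ^ 2 * 1)%R by ring.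
    rewrite <- H. ring.
Qed.

Lemma cpowR_plus (z : R) (s s' : C) : cpowR z (s + s') = cpowR z s * cpowR z s'.
Proof.
  unfold cpowR, Cmult, Cplus; simpl. rewrite !Rmult_plus_distr_r, exp_plus, cos_plus, sin_plus.
  f_equal; ring.
Qed.

Lemma cpowR_mult (x y : R) (s : C) : (0 < x)%R -> (0 < y)%R ->
  cpowR (x * y) s = cpowR x s * cpowR y s.
Proof.
  intros Hx Hy. unfold cpowR, Cmult; simpl. rewrite ln_mult by auto.
  rewrite !Rmult_plus_distr_l, exp_plus, cos_plus, sin_plus. f_equal; ring.
Qed.

Lemma cpowR_R (z a : R) : cpowR z a = Rpower z a.
Proof.
  unfold cpowR, RtoC, Rpower; simpl. rewrite Rmult_0_l, cos_0, sin_0. f_equal; ring.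
Qed.

Lemma Cmod_INR_fact (n : nat) : Cmod (INR (fact n)) = INR (fact n).
Proof. rewrite Cmod_R. apply Rabs_pos_eq, pos_INR. Qed.

Lemma Cmod_gauss_seq (s : C) (n : nat) : (0 < fst s)%R ->
  Cmod (gauss_seq s n) = (INR (fact n) * Rpower (INR n) (fst s) / Cmod (rising_C s n))%R.
Proof.
  intros Hs. rewrite gauss_seq_eq, Cmod_div, Cmod_mult, Cmod_INR_fact, Cmod_cpowR
    by (apply rising_C_nonzero; auto). reflexivity.
Qed.

Lemma gauss_seq_upper (s : C) (n : nat) : (0 < fst s)%R ->
  (Cmod (gauss_seq s n) <= gauss_real (fst s) n)%R.
Proof.
  intros Hs. rewrite Cmod_gauss_seq by auto. unfold gauss_real, Rdiv.
  apply Rmult_le_compat_l.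
  - apply Rmult_le_pos. apply pos_INR. left; apply exp_pos.
  - apply Rinv_le_contravar. apply rising_pos; auto. apply rising_C_lower; auto.
Qed.

(** The exponential factor does not depend on [n], so it survives in the limit and keeps Gamma(s)
    away from 0. *)
Lemma gauss_seq_lower (s : C) (n : nat) : (0 < fst s)%R ->
  (gauss_real (fst s) n * exp (- ((snd s / fst s) ^ 2 + snd s ^ 2 * / fst s)) <= Cmod (gauss_seq s n))%R.
Proof.
  intros Hs. rewrite Cmod_gauss_seq by auto. unfold gauss_real, Rdiv at 1 3.
  rewrite Rmult_assoc.
  apply Rmult_le_compat_l.
  - apply Rmult_le_pos. apply pos_INR. left; apply exp_pos.
  - rewrite exp_Ropp, <- Rinv_mult. apply Rinv_le_contravar.
    + apply Cmod_gt_0, rising_C_nonzero; auto.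
    + eapply Rle_trans. apply rising_C_upper; auto.
      apply Rmult_le_compat_l. left; apply rising_pos; auto.
      assert (H : (snd s ^ 2 * (/ fst s - / (fst s + INR n)) <= snd s ^ 2 * / fst s)%R).
      { apply Rmult_le_compat_l. apply pow2_ge_0.
        assert (0 < / (fst s + INR n))%R by (apply Rinv_0_lt_compat; generalize (pos_INR n); lra). lra. }
      apply exp_le. lra.
Qed.

Lemma gauss_seq_shift (s : C) (n : nat) : (-1 < fst s)%R -> s <> 0 -> (1 <= n)%nat ->
  gauss_seq s n = gauss_seq (s + 1) n * ((1 + (s + 1) * (/ INR n)%R) / s).
Proof.
  intros Hs Hs0 Hn. apply le_INR in Hn. simpl in Hn.
  rewrite !gauss_seq_eq, cpowR_plus.
  assert (Hn0 : RtoC (INR n) <> 0) by (intros E; apply RtoC_inj in E; lra).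
  assert (H1 : rising_C (s + 1) n <> 0) by (apply rising_C_nonzero; simpl; lra).
  assert (H2 : s + INR n + 1 <> 0).
  { replace (s + INR n + 1) with (s + (INR n + 1)%R) by (rewrite RtoC_plus; ring).
    apply RtoC_plus_nonzero. lra. }
  assert (E : rising_C s n = s * rising_C (s + 1) n / (s + INR n + 1)).
  { rewrite rising_C_shift. field. auto. }
  rewrite E, cpowR_R, Rpower_1, RtoC_inv by lra. field. auto.
Qed.

Lemma gauss_seq_R (a : R) (n : nat) : (0 < a)%R -> gauss_seq a n = gauss_real a n.
Proof.
  intros Ha. rewrite gauss_seq_eq, cpowR_R, rising_C_R. unfold gauss_real.
  rewrite RtoC_div by (apply Rgt_not_eq, rising_pos; auto). now rewrite RtoC_mult.
Qed.

(** * Second-order expansions of the real and complex exponential *)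

Lemma Rabs_between_0 (x z : R) : (Rmin 0 x <= z <= Rmax 0 x)%R -> (Rabs z <= Rabs x)%R.
Proof.
  unfold Rmin, Rmax, Rabs. repeat destruct Rle_dec; repeat destruct Rcase_abs; lra.
Qed.

Lemma exp_taylor (x : R) : (Rabs (exp x - 1 - x) <= exp (Rabs x) * x ^ 2)%R.
Proof.
  replace (exp x - 1 - x)%R with (exp x - exp 0 - exp 0 * (x - 0))%R by (rewrite exp_0; ring).
  replace (x ^ 2)%R with ((x - 0) ^ 2)%R by ring.
  apply taylor_order_1 with exp; intros z Hz.
  - apply is_derive_exp.
  - apply is_derive_exp.
  - rewrite Rabs_pos_eq by (left; apply exp_pos). apply exp_le.
    apply Rabs_between_0 in Hz. generalize (Rle_abs z). lra.
Qed.

Lemma exp_lip (x : R) : (Rabs (exp x - 1) <= exp (Rabs x) * Rabs x)%R.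
Proof.
  destruct (MVT_gen exp 0 x exp) as [c [Hc E]].
  - intros; apply is_derive_exp.
  - intros; apply derivable_continuous_pt, derivable_pt_exp.
  - rewrite exp_0, Rminus_0_r in E. rewrite E, Rabs_mult.
    apply Rmult_le_compat_r. apply Rabs_pos.
    rewrite Rabs_pos_eq by (left; apply exp_pos). apply exp_le.
    apply Rabs_between_0 in Hc. generalize (Rle_abs c). lra.
Qed.

Lemma cos_taylor (y : R) : (Rabs (cos y - 1) <= y ^ 2)%R.
Proof.
  replace (cos y - 1)%R with (cos y - cos 0 - (- sin 0) * (y - 0))%R by (rewrite cos_0, sin_0; ring).
  replace (y ^ 2)%R with (1 * (y - 0) ^ 2)%R by ring.
  apply (taylor_order_1 cos (fun y => (- sin y)%R) (fun y => (- cos y)%R)); intros z _.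
  - apply is_derive_cos.
  - auto_derive; auto. ring.
  - rewrite Rabs_Ropp. apply Rabs_le. apply COS_bound.
Qed.

Lemma sin_taylor (y : R) : (Rabs (sin y - y) <= y ^ 2)%R.
Proof.
  replace (sin y - y)%R with (sin y - sin 0 - cos 0 * (y - 0))%R by (rewrite cos_0, sin_0; ring).
  replace (y ^ 2)%R with (1 * (y - 0) ^ 2)%R by ring.
  apply (taylor_order_1 sin cos (fun y => (- sin y)%R)); intros z _.
  - apply is_derive_sin.
  - apply is_derive_cos.
  - rewrite Rabs_Ropp. apply Rabs_le. apply SIN_bound.
Qed.

Lemma sin_lip (y : R) : (Rabs (sin y) <= Rabs y)%R.
Proof.
  destruct (MVT_gen sin 0 y cos) as [c [Hc E]].
  - intros; apply is_derive_sin.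
  - intros; apply derivable_continuous_pt, derivable_pt_sin.
  - rewrite sin_0, !Rminus_0_r in E. rewrite E, Rabs_mult.
    assert (Rabs (cos c) <= 1)%R by (apply Rabs_le, COS_bound).
    generalize (Rabs_pos y). nra.
Qed.

(** This is |e^w - 1 - w| = O(|w|^2) for w = x + iy, meant for w = s ln((n+1)/n). *)
Lemma cexp_taylor (x y : R) :
  (Cmod ((exp x * cos y, exp x * sin y)%R - 1 - (x, y)) <= 4 * exp (Rabs x) * (x ^ 2 + y ^ 2))%R.
Proof.
  eapply Rle_trans; [apply Cmod_le_abs|]. simpl fst; simpl snd.
  replace (exp x * cos y + - (1) + - x)%R with ((exp x - 1 - x) + exp x * (cos y - 1))%R by ring.
  replace (exp x * sin y + - 0 + - y)%R with ((exp x - 1) * sin y + (sin y - y))%R by ring.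
  assert (HE : (1 <= exp (Rabs x))%R) by (rewrite <- exp_0; apply exp_le, Rabs_pos).
  assert (HE2 : (exp x <= exp (Rabs x))%R) by (apply exp_le, Rle_abs).
  assert (Hx := exp_pos x).
  assert (A1 := exp_taylor x). assert (A2 := exp_lip x).
  assert (A3 := cos_taylor y). assert (A4 := sin_taylor y). assert (A5 := sin_lip y).
  assert (B1 : (Rabs (exp x * (cos y - 1)) <= exp (Rabs x) * y ^ 2)%R).
  { rewrite Rabs_mult, (Rabs_pos_eq (exp x)) by lra.
    apply Rmult_le_compat; auto using Rabs_pos. lra. }
  assert (B2 : (Rabs ((exp x - 1) * sin y) <= exp (Rabs x) * (x ^ 2 + y ^ 2))%R).
  { rewrite Rabs_mult.
    apply Rle_trans with (exp (Rabs x) * Rabs x * Rabs y)%R.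
    - apply Rmult_le_compat; auto using Rabs_pos.
    - rewrite Rmult_assoc. apply Rmult_le_compat_l; [lra|].
      rewrite <- (pow2_abs x), <- (pow2_abs y).
      generalize (Rabs_pos x) (Rabs_pos y). nra. }
  assert (B3 : (y ^ 2 <= exp (Rabs x) * y ^ 2)%R) by (generalize (pow2_ge_0 y); nra).
  assert (B4 : (0 <= exp (Rabs x) * x ^ 2)%R) by (generalize (pow2_ge_0 x); nra).
  eapply Rle_trans; [apply Rplus_le_compat; apply Rabs_triang|]. generalize (pow2_ge_0 y). lra.
Qed.

(** * Convergence of Gauss' sequence in the right half-plane *)

Lemma ln_ratio_bounds (n : nat) : (1 <= n)%nat ->
  (/ (INR n + 1) <= ln ((INR n + 1) / INR n) <= / INR n)%R.
Proof.
  intros Hn. apply le_INR in Hn. simpl in Hn.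
  assert (H : forall x, (0 < x)%R -> (ln x <= x - 1)%R).
  { intros x Hx. generalize (exp_ineq1_le (ln x)). rewrite exp_ln by auto. lra. }
  assert (H1 : (0 < (INR n + 1) / INR n)%R) by (apply Rdiv_lt_0_compat; lra).
  split.
  - assert (H2 := H (/ ((INR n + 1) / INR n))%R (Rinv_0_lt_compat _ H1)).
    rewrite ln_Rinv in H2 by auto.
    replace (/ ((INR n + 1) / INR n) - 1)%R with (- / (INR n + 1))%R in H2 by (field; lra). lra.
  - specialize (H _ H1). replace ((INR n + 1) / INR n - 1)%R with (/ INR n)%R in H by (field; lra). lra.
Qed.

(** The step is O(1/n^2), stated through 1/n - 1/(n+1) so that sums of steps telescope. Only Re s
    and [T] occur in the constant, which makes the rate uniform on a segment. *)
Lemma gauss_seq_step_le (s : C) (n : nat) (T : R) : (0 < fst s)%R -> (Rabs (snd s) <= T)%R -> (1 <= n)%nat ->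
  (Cmod (gauss_seq s (S n) - gauss_seq s n) <=
   gauss_real (fst s) n * ((8 * exp (fst s) * (fst s ^ 2 + T ^ 2) + fst s + T) * (/ INR n - / (INR n + 1))))%R.
Proof.
  intros Hs HT Hn. assert (HL := ln_ratio_bounds n Hn).
  assert (Hn1 := le_INR _ _ Hn). simpl in Hn1.
  set (L := ln ((INR n + 1) / INR n)) in *.
  set (E := cpowR ((INR n + 1) / INR n) s).
  assert (Hnz : RtoC (INR n) + 1 <> 0).
  { rewrite <- RtoC_plus. intros F; apply RtoC_inj in F. lra. }
  assert (H1 : rising_C s n <> 0) by (apply rising_C_nonzero; auto).
  assert (H2 : s + (INR n + 1) <> 0).
  { rewrite <- RtoC_plus. apply RtoC_plus_nonzero. lra. }
  (* The ratio of consecutive terms is E (n+1) / (s+n+1) with E = exp(s L). Subtracting 1 leaves E -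
     1 - s/(n+1), split into the Taylor error at s L and s times the error of L against 1/(n+1). *)
  assert (Eq : gauss_seq s (S n) - gauss_seq s n =
    gauss_seq s n * ((INR n + 1) / (s + (INR n + 1)) * ((E - 1 - s * L) + s * (L - / (INR n + 1))%R))).
  { rewrite !gauss_seq_eq, rising_C_S, fact_simpl, mult_INR, !S_INR, RtoC_mult, RtoC_minus, RtoC_inv, RtoC_plus by lra.
    replace (cpowR (INR n + 1) s) with (cpowR (INR n) s * E).
    - field. auto.
    - unfold E. rewrite <- cpowR_mult by (try apply Rdiv_lt_0_compat; lra). f_equal. field. lra. }
  rewrite Eq, !Cmod_mult. apply Rmult_le_compat; auto using Cmod_ge_0.
  - apply Rmult_le_pos; apply Cmod_ge_0.
  - apply gauss_seq_upper; auto.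
  - assert (HD : (Cmod ((INR n + 1) / (s + (INR n + 1))) <= 1)%R).
    { rewrite Cmod_div by auto. rewrite <- RtoC_plus, Cmod_R, Rabs_pos_eq by lra.
      assert (HA : (INR n + 1 <= Cmod (s + (INR n + 1)%R))%R).
      { eapply Rle_trans; [|apply fst_le_Cmod]. simpl. lra. }
      apply Rmult_le_reg_r with (Cmod (s + (INR n + 1)%R)); [lra|].
      unfold Rdiv. rewrite Rmult_assoc, Rinv_l by lra. lra. }
    set (Q := (E - 1 - s * L + s * (L - / (INR n + 1))%R)).
    apply Rle_trans with (Cmod Q).
    { assert (A := Cmod_ge_0 Q). apply (Rmult_le_compat_r _ _ _ A) in HD. lra. }
    unfold Q. eapply Rle_trans; [apply Cmod_triangle|].
    assert (HiN : (0 < / (INR n + 1))%R) by (apply Rinv_0_lt_compat; lra).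
    assert (HiN1 : (/ INR n <= 1)%R) by (rewrite <- Rinv_1; apply Rinv_le_contravar; lra).
    (* From L <= 1/n and n + 1 <= 2n; this 2 and the 4 of [cexp_taylor] make the 8. *)
    assert (Hin2 : (L ^ 2 <= 2 * (/ INR n - / (INR n + 1)))%R).
    { apply Rle_trans with ((/ INR n) ^ 2)%R. { apply pow_incr; lra. }
      replace (/ INR n - / (INR n + 1))%R with (/ INR n * / (INR n + 1))%R by (field; lra).
      replace ((/ INR n) ^ 2)%R with (/ INR n * / INR n)%R by ring.
      replace (2 * (/ INR n * / (INR n + 1)))%R with (/ INR n * (2 * / (INR n + 1)))%R by ring.
      apply Rmult_le_compat_l. left; apply Rinv_0_lt_compat; lra.
      apply Rmult_le_reg_r with (INR n * (INR n + 1))%R. nra.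
      replace (/ INR n * (INR n * (INR n + 1)))%R with (INR n + 1)%R by (field; lra).
      replace (2 * / (INR n + 1) * (INR n * (INR n + 1)))%R with (2 * INR n)%R by (field; lra). lra. }
    assert (HsT : (snd s ^ 2 <= T ^ 2)%R).
    { rewrite <- (pow2_abs (snd s)). apply pow_incr. split; auto. apply Rabs_pos. }
    assert (Hes : (0 < exp (fst s))%R) by apply exp_pos.
    assert (P1 : (Cmod (E - 1 - s * L) <= 8 * exp (fst s) * (fst s ^ 2 + T ^ 2) * (/ INR n - / (INR n + 1)))%R).
    { replace (s * L) with ((fst s * L, snd s * L)%R : C)
        by (unfold Cmult, RtoC; simpl; f_equal; ring).
      unfold E, cpowR. fold L.
      eapply Rle_trans; [apply cexp_taylor|].
      assert (HeL : (exp (Rabs (fst s * L)) <= exp (fst s))%R).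
      { apply exp_le. rewrite Rabs_pos_eq by nra. nra. }
      apply Rle_trans with (4 * exp (fst s) * ((fst s ^ 2 + T ^ 2) * L ^ 2))%R.
      - rewrite !(Rmult_assoc 4). apply Rmult_le_compat_l; [lra|].
        apply Rmult_le_compat; auto.
        + left; apply exp_pos.
        + generalize (pow2_ge_0 (fst s * L)) (pow2_ge_0 (snd s * L)). lra.
        + replace ((fst s * L) ^ 2 + (snd s * L) ^ 2)%R with ((fst s ^ 2 + snd s ^ 2) * L ^ 2)%R by ring.
          apply Rmult_le_compat_r. apply pow2_ge_0. lra.
      - replace (8 * exp (fst s) * (fst s ^ 2 + T ^ 2) * (/ INR n - / (INR n + 1)))%R
          with (4 * exp (fst s) * ((fst s ^ 2 + T ^ 2) * (2 * (/ INR n - / (INR n + 1)))))%R by ring.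
        apply Rmult_le_compat_l; [lra|]. apply Rmult_le_compat_l; auto.
        generalize (pow2_ge_0 (fst s)) (pow2_ge_0 T). lra. }
    assert (P2 : (Cmod (s * (L - / (INR n + 1))%R) <= (fst s + T) * (/ INR n - / (INR n + 1)))%R).
    { rewrite Cmod_mult, Cmod_R, Rabs_pos_eq by lra. apply Rmult_le_compat; try lra. apply Cmod_ge_0.
      eapply Rle_trans; [apply Cmod_le_abs|]. rewrite (Rabs_pos_eq (fst s)) by lra. lra. }
    lra.
Qed.

Definition is_Clim (u : nat -> C) (l : C) : Prop :=
  is_lim_seq (fun n => fst (u n)) (fst l) /\ is_lim_seq (fun n => snd (u n)) (snd l).

Lemma is_Clim_mult (u v : nat -> C) (a b : C) :
  is_Clim u a -> is_Clim v b -> is_Clim (fun n => u n * v n) (a * b).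
Proof.
  intros [H1 H2] [H3 H4]. split; simpl.
  - apply is_lim_seq_minus'; apply is_lim_seq_mult'; auto.
  - apply is_lim_seq_plus'; apply is_lim_seq_mult'; auto.
Qed.

Lemma is_Clim_Cmod (u : nat -> C) (l : C) :
  is_Clim u l -> is_lim_seq (fun n => Cmod (u n)) (Cmod l).
Proof.
  intros [H1 H2]. unfold Cmod.
  apply (is_lim_seq_continuous sqrt (fun n => fst (u n) ^ 2 + snd (u n) ^ 2)%R).
  - apply continuity_pt_filterlim, continuous_sqrt.
  - simpl. apply is_lim_seq_plus'; apply is_lim_seq_mult'; auto;
    apply is_lim_seq_mult'; auto; apply is_lim_seq_const.
Qed.

Lemma CGamma_unique (s l : C) : is_Clim (gauss_seq s) l -> CGamma s = l.
Proof.
  intros [H1 H2]. unfold CGamma.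
  rewrite (is_lim_seq_unique _ _ H1), (is_lim_seq_unique _ _ H2). destruct l; reflexivity.
Qed.

(** [D] and [N] are chosen before [s]: this uniformity is what later gives continuity in Im s. *)
Lemma gauss_seq_cauchy (x T : R) : (0 < x)%R -> (0 <= T)%R ->
  exists D N, (0 <= D)%R /\ (1 <= N)%nat /\
  forall s, fst s = x -> (Rabs (snd s) <= T)%R -> forall n p, (N <= n)%nat ->
    (Cmod (gauss_seq s (n + p) - gauss_seq s n) <= D * (/ INR n - / INR (n + p)))%R.
Proof.
  intros Hx HT.
  destruct (gauss_real_lim x 1 Hx Rlt_0_1) as [HL Hpos].
  set (l := euler_int x 1) in *.
  (* The real sequence, which dominates the moduli, is eventually below l + 1. *)
  destruct (HL (fun y => y < l + 1)%R) as [N0 HN0].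
  { exists (mkposreal 1 Rlt_0_1). intros y Hy.
    apply ball_R_between in Hy; simpl in Hy. lra. }
  set (D0 := (8 * exp x * (x ^ 2 + T ^ 2) + x + T)%R).
  assert (HD0 : (0 <= D0)%R).
  { unfold D0. generalize (exp_pos x) (pow2_ge_0 x) (pow2_ge_0 T). intros.
    assert (0 <= 8 * exp x * (x ^ 2 + T ^ 2))%R by (apply Rmult_le_pos; lra). lra. }
  exists ((l + 1) * D0)%R, (Nat.max 1 N0). repeat split.
  - apply Rmult_le_pos; lra.
  - lia.
  - intros s Hs Hsnd n p Hn. induction p.
    + rewrite Nat.add_0_r. replace (gauss_seq s n - gauss_seq s n) with (RtoC 0) by ring.
      rewrite Cmod_0. lra.
    + replace (gauss_seq s (n + S p) - gauss_seq s n)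
        with ((gauss_seq s (S (n + p)) - gauss_seq s (n + p)) + (gauss_seq s (n + p) - gauss_seq s n))
        by (rewrite Nat.add_succ_r; ring).
      eapply Rle_trans; [apply Cmod_triangle|].
      assert (H1 : (Cmod (gauss_seq s (S (n + p)) - gauss_seq s (n + p)) <=
        (l + 1) * D0 * (/ INR (n + p) - / INR (n + S p)))%R).
      { eapply Rle_trans; [apply (gauss_seq_step_le s (n + p) T); try lra; try lia|].
        rewrite Hs. fold D0. rewrite Nat.add_succ_r, S_INR, Rmult_assoc.
        apply Rmult_le_compat_r.
        - apply Rmult_le_pos; auto.
          assert (1 <= INR (n + p))%R by (apply (le_INR 1); lia).
          assert (/ (INR (n + p) + 1) <= / INR (n + p))%R by (apply Rinv_le_contravar; lra). lra.
        - left. apply HN0. lia. }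
      lra.
Qed.

Lemma ex_finite_lim_seq_tail (u : nat -> R) (D : R) (N : nat) : (0 <= D)%R -> (1 <= N)%nat ->
  (forall n p, (N <= n)%nat -> (Rabs (u (n + p)%nat - u n) <= D * / INR n)%R) ->
  is_lim_seq u (real (Lim_seq u)) /\
  forall n, (N <= n)%nat -> (Rabs (real (Lim_seq u) - u n) <= D * / INR n)%R.
Proof.
  intros HD HN H.
  assert (Hinv : is_lim_seq (fun n => D * / (INR n + 0))%R 0).
  { replace (Finite 0) with (Rbar_mult D 0) by (simpl; f_equal; ring).
    apply is_lim_seq_scal_l, is_lim_seq_inv_INR. }
  assert (Hl : is_lim_seq u (real (Lim_seq u))).
  { apply Lim_seq_correct'. apply ex_lim_seq_cauchy_corr. intros eps.
    assert (He : (0 < eps / 2)%R) by (generalize (cond_pos eps); lra).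
    destruct (Hinv (fun y => y < eps / 2)%R) as [M HM].
    { exists (mkposreal _ He). intros y Hy.
      apply ball_R_between in Hy; simpl in Hy. lra. }
    set (K := Nat.max M N). exists K. intros n m Hn Hm.
    assert (HK : (D * / INR K < eps / 2)%R).
    { rewrite <- (Rplus_0_r (INR K)). apply HM. unfold K; lia. }
    assert (A : (Rabs (u n - u K) <= D * / INR K)%R).
    { replace n with (K + (n - K))%nat by lia. apply H. unfold K; lia. }
    assert (B : (Rabs (u m - u K) <= D * / INR K)%R).
    { replace m with (K + (m - K))%nat by lia. apply H. unfold K; lia. }
    replace (u n - u m)%R with ((u n - u K) - (u m - u K))%R by ring.
    eapply Rle_lt_trans; [apply Rabs_triang|]. rewrite Rabs_Ropp. lra. }
  split; auto.
  intros n Hn.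
  apply (is_lim_seq_le_loc (fun p => Rabs (u p - u n)) (fun _ => D * / INR n)%R
    (Rabs (real (Lim_seq u) - u n)) (D * / INR n)%R).
  - exists n. intros p Hp. replace p with (n + (p - n))%nat by lia. auto.
  - apply (is_lim_seq_abs (fun p => u p - u n)%R (real (Lim_seq u) - u n)%R).
    apply is_lim_seq_minus'; auto. apply is_lim_seq_const.
  - apply is_lim_seq_const.
Qed.

Lemma CGamma_uniform (x T : R) : (0 < x)%R -> (0 <= T)%R ->
  exists D N, (0 <= D)%R /\ (1 <= N)%nat /\
  forall s, fst s = x -> (Rabs (snd s) <= T)%R ->
    is_Clim (gauss_seq s) (CGamma s) /\
    forall n, (N <= n)%nat ->
      (Rabs (fst (CGamma s) - fst (gauss_seq s n)) <= D * / INR n)%R /\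
      (Rabs (snd (CGamma s) - snd (gauss_seq s n)) <= D * / INR n)%R.
Proof.
  intros Hx HT. destruct (gauss_seq_cauchy x T Hx HT) as (D & N & HD & HN & H).
  exists D, N. split; [auto|split; [auto|]]. intros s Hs Hsnd.
  assert (HC : forall n p, (N <= n)%nat ->
     (Cmod (gauss_seq s (n + p) - gauss_seq s n) <= D * / INR n)%R).
  { intros n p Hn. eapply Rle_trans; [apply H; auto|]. apply Rmult_le_compat_l; auto.
    assert (0 < / INR (n + p))%R by (apply Rinv_0_lt_compat, lt_0_INR; lia). lra. }
  destruct (ex_finite_lim_seq_tail (fun n => fst (gauss_seq s n)) D N HD HN) as [A1 A2].
  { intros n p Hn. eapply Rle_trans; [|apply (HC n p Hn)].
    eapply Rle_trans; [|apply Rmax_Cmod]. apply Rmax_l. }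
  destruct (ex_finite_lim_seq_tail (fun n => snd (gauss_seq s n)) D N HD HN) as [B1 B2].
  { intros n p Hn. eapply Rle_trans; [|apply (HC n p Hn)].
    eapply Rle_trans; [|apply Rmax_Cmod]. apply Rmax_r. }
  split; [split; auto|]. intros n Hn. split; auto.
Qed.

Lemma CGamma_lim (s : C) : (0 < fst s)%R -> is_Clim (gauss_seq s) (CGamma s).
Proof.
  intros Hs. destruct (CGamma_uniform (fst s) (Rabs (snd s)) Hs (Rabs_pos _)) as (D & N & _ & _ & H).
  apply H; auto. lra.
Qed.

(** The strip reaches down to Re s > -1 because the second G-function contains Gamma(s-1) with only
    Re s > 0. Convergence at [s] is not presupposed: it is inherited from s + 1, which lies in the
    right half-plane. *)
Lemma CGamma_shift (s : C) : (-1 < fst s)%R -> s <> 0 -> CGamma s = CGamma (s + 1) / s.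
Proof.
  intros Hs Hs0. apply CGamma_unique.
  assert (HL : is_Clim (fun n => gauss_seq (s + 1) n * ((1 + (s + 1) * (/ INR n)%R) * / s)) (CGamma (s + 1) * (1 * / s))).
  { apply is_Clim_mult. apply CGamma_lim; simpl; lra.
    apply is_Clim_mult; [|split; apply is_lim_seq_const].
    assert (Hi : is_lim_seq (fun n => / INR n)%R 0).
    { apply is_lim_seq_ext with (fun n => / (INR n + 0))%R. intros; now rewrite Rplus_0_r.
      apply is_lim_seq_inv_INR. }
    split; simpl.
    - replace (Finite 1) with (Finite (1 + ((fst s + 1) * 0 - (snd s + 0) * 0))%R) by (f_equal; ring).
      apply is_lim_seq_plus'. apply is_lim_seq_const.
      apply is_lim_seq_minus'; apply is_lim_seq_mult'; auto; apply is_lim_seq_const.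
    - replace (Finite 0) with (Finite (0 + ((fst s + 1) * 0 + (snd s + 0) * 0))%R) by (f_equal; ring).
      apply is_lim_seq_plus'. apply is_lim_seq_const.
      apply is_lim_seq_plus'; apply is_lim_seq_mult'; auto; apply is_lim_seq_const. }
  rewrite Cmult_1_l in HL. destruct HL as [H1 H2].
  split; [eapply is_lim_seq_ext_loc; [|exact H1]|eapply is_lim_seq_ext_loc; [|exact H2]];
    exists 1%nat; intros n Hn; f_equal; symmetry; apply gauss_seq_shift; auto.
Qed.

Lemma Cmod_CGamma_le (s : C) : (0 < fst s)%R -> (Cmod (CGamma s) <= euler_int (fst s) 1)%R.
Proof.
  intros Hs. apply (is_lim_seq_le (fun n => Cmod (gauss_seq s n)) (gauss_real (fst s))
    (Cmod (CGamma s)) (euler_int (fst s) 1)).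
  - intros n. apply gauss_seq_upper; auto.
  - apply is_Clim_Cmod, CGamma_lim; auto.
  - apply gauss_real_lim; auto; lra.
Qed.

Lemma CGamma_nonzero (s : C) : (0 < fst s)%R -> CGamma s <> 0.
Proof.
  intros Hs. apply Cmod_gt_0.
  destruct (gauss_real_lim (fst s) 1 Hs Rlt_0_1) as [HL Hp].
  set (K := exp (- ((snd s / fst s) ^ 2 + snd s ^ 2 * / fst s))).
  apply Rlt_le_trans with (euler_int (fst s) 1 * K)%R.
  { apply Rmult_lt_0_compat; auto. apply exp_pos. }
  apply (is_lim_seq_le (fun n => gauss_real (fst s) n * K)%R (fun n => Cmod (gauss_seq s n))
    (euler_int (fst s) 1 * K)%R (Cmod (CGamma s))).
  - intros n. apply gauss_seq_lower; auto.
  - apply is_lim_seq_mult'; auto. apply is_lim_seq_const.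
  - apply is_Clim_Cmod, CGamma_lim; auto.
Qed.

(** Holding for every rate [mu], this also says that Euler's integral does not depend on it. *)
Lemma Gamma_euler (a mu : R) : (0 < a)%R -> (0 < mu)%R -> Gamma a = euler_int a mu.
Proof.
  intros Ha Hmu. unfold Gamma.
  rewrite (CGamma_unique a (euler_int a mu)); auto.
  split.
  - apply is_lim_seq_ext with (gauss_real a).
    intros n; now rewrite gauss_seq_R. apply gauss_real_lim; auto.
  - apply is_lim_seq_ext with (fun _ => 0%R).
    intros n; now rewrite gauss_seq_R. apply is_lim_seq_const.
Qed.

Lemma Gamma_pos (a : R) : (0 < a)%R -> (0 < Gamma a)%R.
Proof. intros Ha. rewrite (Gamma_euler a 1) by lra. apply gauss_real_lim; lra. Qed.

Lemma Cmod2_line (x t : R) : (Cmod (x, t) ^ 2 = x ^ 2 + t ^ 2)%R.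
Proof. apply Cmod2_alt. Qed.

Lemma CGamma_decay (x : R) : (0 < x)%R ->
  exists K, (0 <= K)%R /\ forall t, (Cmod (CGamma (x, t)) <= K / (1 + t ^ 2))%R.
Proof.
  (* [B] bounds |Gamma(s+2)|; [q] is chosen so that q (1 + t^2) <= x^2 + t^2 = |s|^2 <= |s|
     |s+1|. *)
  intros Hx. set (B := euler_int (x + 1 + 1) 1). set (q := Rmin (x ^ 2) 1).
  assert (HB : (0 < B)%R) by (apply gauss_real_lim; lra).
  assert (Hx2 : (0 < x ^ 2)%R) by (apply pow_lt; auto).
  assert (Hq : (0 < q)%R) by (apply Rmin_pos; lra).
  exists (B / q)%R. split. { apply Rlt_le, Rdiv_lt_0_compat; auto. }
  intros t.
  assert (N0 : ((x, t) : C) <> 0) by (intros E; apply (f_equal fst) in E; simpl in E; lra).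
  assert (N1 : (x, t) + 1 <> 0) by (intros E; apply (f_equal fst) in E; simpl in E; lra).
  rewrite CGamma_shift, (CGamma_shift ((x, t) + 1)) by (simpl; auto; lra).
  rewrite !Cmod_div by auto.
  assert (H1 : (Cmod (CGamma ((x, t) + 1 + 1)) <= B)%R).
  { apply Cmod_CGamma_le. simpl; lra. }
  assert (H2 : (Cmod (x, t) <= Cmod ((x, t) + 1))%R).
  { apply Rsqr_incr_0_var; [|apply Cmod_ge_0]. unfold Rsqr.
    generalize (Cmod2_line x t) (Cmod2_alt ((x, t) + 1)). simpl. intros. nra. }
  assert (H3 : (0 < Cmod (x, t))%R) by (apply Cmod_gt_0; auto).
  assert (Hq1 : (q * (1 + t ^ 2) <= Cmod (x, t) ^ 2)%R).
  { rewrite Cmod2_line. unfold q. generalize (Rmin_l (x ^ 2) 1) (Rmin_r (x ^ 2) 1) (pow2_ge_0 t). nra. }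
  assert (Ht : (0 < 1 + t ^ 2)%R) by (generalize (pow2_ge_0 t); lra).
  unfold Rdiv. rewrite !Rmult_assoc, <- !Rinv_mult.
  apply Rmult_le_compat; auto using Cmod_ge_0.
  - left. apply Rinv_0_lt_compat. apply Rmult_lt_0_compat; lra.
  - apply Rinv_le_contravar; nra.
Qed.

(** * Continuity of Gamma along vertical lines *)

Definition Ccont (f : R -> C) : Prop :=
  (forall t, continuous (fun t => fst (f t)) t) /\ (forall t, continuous (fun t => snd (f t)) t).

Lemma continuous_Rmult (f g : R -> R) (t : R) :
  continuous f t -> continuous g t -> continuous (fun t => f t * g t)%R t.
Proof. intros; now apply (continuous_mult (K := R_AbsRing)). Qed.

Lemma continuous_Rplus (f g : R -> R) (t : R) :
  continuous f t -> continuous g t -> continuous (fun t => f t + g t)%R t.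
Proof. intros; now apply (continuous_plus (V := R_NormedModule)). Qed.

Lemma continuous_Ropp (f : R -> R) (t : R) :
  continuous f t -> continuous (fun t => - f t)%R t.
Proof. intros; now apply (continuous_opp (V := R_NormedModule)). Qed.

Lemma Ccont_ext (f g : R -> C) : (forall t, f t = g t) -> Ccont f -> Ccont g.
Proof.
  intros E [H1 H2]. split; intros t;
    [eapply continuous_ext; [|apply (H1 t)]|eapply continuous_ext; [|apply (H2 t)]];
    intros u; simpl; now rewrite E.
Qed.

Lemma Ccont_const (z : C) : Ccont (fun _ => z).
Proof. split; intros t; apply continuous_const. Qed.

Lemma Ccont_line (x : R) : Ccont (fun t => (x, t)).
Proof. split; intros t; simpl. apply continuous_const. apply continuous_id. Qed.

Lemma Ccont_plus (f g : R -> C) : Ccont f -> Ccont g -> Ccont (fun t => f t + g t).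
Proof. intros [A B] [A' B']. split; intros t; simpl; apply continuous_Rplus; auto. Qed.

Lemma Ccont_mult (f g : R -> C) : Ccont f -> Ccont g -> Ccont (fun t => f t * g t).
Proof.
  intros [A B] [A' B']. split; intros t; simpl; apply continuous_Rplus;
    try apply continuous_Ropp; apply continuous_Rmult; auto.
Qed.

Lemma Ccont_inv (f : R -> C) : (forall t, f t <> 0) -> Ccont f -> Ccont (fun t => / f t).
Proof.
  intros Hf [A B].
  assert (Hc : forall t, continuous (fun t => / (fst (f t) ^ 2 + snd (f t) ^ 2))%R t).
  { intros t. apply continuous_Rinv_comp.
    - simpl. apply continuous_Rplus; apply continuous_Rmult; auto; apply continuous_Rmult; auto; apply continuous_const.
    - assert (H := proj1 (Cmod_gt_0 _) (Hf t)).
      assert (E := Cmod2_alt (f t)). unfold Re, Im in E. rewrite <- E. apply pow_nonzero. lra. }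
  split; intros t; simpl; unfold Rdiv; apply continuous_Rmult; auto; apply Hc || apply continuous_Ropp; auto.
Qed.

Lemma Ccont_comp_opp (f : R -> C) : Ccont f -> Ccont (fun t => f (- t)%R).
Proof.
  intros [A B]. split; intros t.
  - apply (continuous_comp Ropp (fun t => fst (f t))); auto. apply continuous_Ropp, continuous_id.
  - apply (continuous_comp Ropp (fun t => snd (f t))); auto. apply continuous_Ropp, continuous_id.
Qed.

Lemma Ccont_cpowR (z x : R) : Ccont (fun t => cpowR z (x, t)).
Proof.
  split; intros t; apply @ex_derive_continuous; unfold cpowR; simpl; auto_derive; auto.
Qed.

Lemma Ccont_rising_C (x : R) (n : nat) : Ccont (fun t => rising_C (x, t) n).
Proof.
  induction n.
  - apply Ccont_ext with (fun t => (x, t)). intros; now rewrite rising_C_0. apply Ccont_line.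
  - apply Ccont_ext with (fun t => rising_C (x, t) n * ((x, t) + INR (S n))).
    intros; now rewrite rising_C_S.
    apply Ccont_mult; auto. apply Ccont_plus. apply Ccont_line. apply Ccont_const.
Qed.

Lemma Ccont_gauss_seq (x : R) (n : nat) : (0 < x)%R -> Ccont (fun t => gauss_seq (x, t) n).
Proof.
  intros Hx. apply Ccont_ext with (fun t => INR (fact n) * cpowR (INR n) (x, t) * / rising_C (x, t) n).
  reflexivity.
  apply Ccont_mult. apply Ccont_mult. apply Ccont_const. apply Ccont_cpowR.
  apply Ccont_inv. intros t; apply rising_C_nonzero; auto. apply Ccont_rising_C.
Qed.

Lemma continuous_uniform_lim (u : nat -> R -> R) (f : R -> R) (t D : R) (N : nat) :
  (0 <= D)%R -> (1 <= N)%nat ->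
  (forall n y, continuous (u n) y) ->
  (forall n y, (N <= n)%nat -> (Rabs (y - t) < 1)%R -> (Rabs (f y - u n y) <= D * / INR n)%R) ->
  continuous f t.
Proof.
  intros HD HN Hc H. apply continuity_pt_filterlim.
  apply (CVU_continuity u f t (mkposreal 1 Rlt_0_1)).
  - intros eps He.
    assert (Hinv : is_lim_seq (fun n => D * / (INR n + 0))%R 0).
    { replace (Finite 0) with (Rbar_mult D 0) by (simpl; f_equal; ring).
      apply is_lim_seq_scal_l, is_lim_seq_inv_INR. }
    destruct (Hinv (fun y => y < eps)%R) as [M HM].
    { exists (mkposreal _ He). intros y Hy.
      apply ball_R_between in Hy; simpl in Hy. lra. }
    exists (Nat.max M N). intros n y Hn Hy.
    apply Rle_lt_trans with (D * / INR n)%R. apply H; auto; lia.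
    rewrite <- (Rplus_0_r (INR n)). apply HM. lia.
  - intros n y _. apply continuity_pt_filterlim, Hc.
  - unfold Boule. rewrite Rminus_diag, Rabs_R0. simpl; lra.
Qed.

Lemma Ccont_CGamma (x : R) : (0 < x)%R -> Ccont (fun t => CGamma (x, t)).
Proof.
  intros Hx.
  (* The height |t| + 1 covers the unit ball around t, on which the convergence must be uniform. *)
  assert (HT : forall t, (0 <= Rabs t + 1)%R) by (intros t; generalize (Rabs_pos t); lra).
  assert (Hy : forall t y, (Rabs (y - t) < 1 -> Rabs y <= Rabs t + 1)%R).
  { intros t y H. replace y with ((y - t) + t)%R by ring.
    eapply Rle_trans; [apply Rabs_triang|]. lra. }
  split; intros t;
    destruct (CGamma_uniform x (Rabs t + 1) Hx (HT t)) as (D & N & HD & HN & H).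
  - apply (continuous_uniform_lim (fun n t => fst (gauss_seq (x, t) n)) _ t D N HD HN).
    + intros n y. exact (proj1 (Ccont_gauss_seq x n Hx) y).
    + intros n y Hn Hyt. exact (proj1 (proj2 (H (x, y) eq_refl (Hy t y Hyt)) n Hn)).
  - apply (continuous_uniform_lim (fun n t => snd (gauss_seq (x, t) n)) _ t D N HD HN).
    + intros n y. exact (proj2 (Ccont_gauss_seq x n Hx) y).
    + intros n y Hn Hyt. exact (proj2 (proj2 (H (x, y) eq_refl (Hy t y Hyt)) n Hn)).
Qed.

(** * Mellin-Barnes integrals *)

Definition cexp_line (c w t : R) : C := (exp (c * w) * cos (t * w), exp (c * w) * sin (t * w))%R.

(** Up to the factor 2 pi, the real part of the inverse Mellin transform along Re s = c, at z = e^w;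
    [cexp_line c w t] is z^s for s = c + it. *)
Definition mellin_barnes (c : R) (G : R -> C) (w : R) : R :=
  RInt_line (fun t => fst (G t * cexp_line c w t)).

Lemma is_derive_cexp_line (g : C) (c w t : R) :
  is_derive (fun w => fst (g * cexp_line c w t)) w (fst ((c, t) * g * cexp_line c w t)).
Proof.
  destruct g as [g1 g2]. unfold cexp_line, Cmult; simpl. auto_derive; auto. ring.
Qed.

Lemma Cmod_cexp_line (c w t : R) : Cmod (cexp_line c w t) = exp (c * w).
Proof.
  replace (cexp_line c w t) with (cpowR (exp w) (c, t))
    by (unfold cpowR, cexp_line; simpl; now rewrite ln_exp).
  now rewrite Cmod_cpowR, ln_exp.
Qed.

(** Two Gamma factors decay like 1/(1+t^2)^2. Up to two powers of s, as many as
    [is_derive_RInt_line] asks for, therefore leave an integrable 1/(1+t^2). *)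
Lemma Cmod_line_pow_le (c t : R) (n : nat) : (n <= 2)%nat ->
  (Cmod (c, t) ^ n <= (c ^ 2 + 1) * (1 + t ^ 2))%R.
Proof.
  intros Hn. assert (H := Cmod2_line c t). assert (H0 := Cmod_ge_0 (c, t)).
  assert (A := pow2_ge_0 c). assert (B := pow2_ge_0 t).
  destruct n as [|[|[|n]]]; try lia; [| |rewrite H]; simpl in *; nra.
Qed.

Lemma mellin_integrand_le (c w t C0 : R) (G : C) (n : nat) : (n <= 2)%nat ->
  (Cmod G <= C0 / (1 + t ^ 2) ^ 2)%R ->
  (Cmod (c, t) ^ n * Cmod G * exp (c * w) <= C0 * (c ^ 2 + 1) * exp (c * w) / (1 + t ^ 2))%R.
Proof.
  intros Hn HG. assert (H := Cmod_line_pow_le c t n Hn).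
  assert (Ht : (0 < 1 + t ^ 2)%R) by (generalize (pow2_ge_0 t); lra).
  replace (C0 * (c ^ 2 + 1) * exp (c * w) / (1 + t ^ 2))%R
    with ((c ^ 2 + 1) * (1 + t ^ 2) * (C0 / (1 + t ^ 2) ^ 2) * exp (c * w))%R by (field; lra).
  apply Rmult_le_compat_r. left; apply exp_pos.
  apply Rmult_le_compat; auto using Cmod_ge_0. apply pow_le, Cmod_ge_0.
Qed.

Lemma Ccont_cexp_line (c w : R) : Ccont (fun t => cexp_line c w t).
Proof.
  split; intros t; apply @ex_derive_continuous; unfold cexp_line; simpl; auto_derive; auto.
Qed.

Lemma ex_mellin_barnes (c w C0 : R) (G : R -> C) (n : nat) : (n <= 2)%nat ->
  Ccont G -> (forall t, (Cmod (G t) <= C0 / (1 + t ^ 2) ^ 2)%R) ->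
  ex_RInt_line (fun t => fst (Cpow (c, t) n * G t * cexp_line c w t)).
Proof.
  intros Hn HG HC. apply ex_RInt_line_dom with (C0 * (c ^ 2 + 1) * exp (c * w))%R.
  - assert (HP : Ccont (fun t => Cpow (c, t) n)).
    { clear Hn. induction n; simpl. apply Ccont_const. apply Ccont_mult; auto. apply Ccont_line. }
    exact (proj1 (Ccont_mult _ _ (Ccont_mult _ _ HP HG) (Ccont_cexp_line c w))).
  - intros t. eapply Rle_trans; [apply re_le_Cmod|].
    rewrite !Cmod_mult, Cmod_pow, Cmod_cexp_line. apply mellin_integrand_le; auto.
Qed.

Lemma mellin_barnes_ext (c w : R) (G H : R -> C) : (forall t, t <> 0%R -> G t = H t) ->
  ex_RInt_line (fun t => fst (G t * cexp_line c w t)) ->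
  mellin_barnes c H w = mellin_barnes c G w.
Proof.
  intros E Hex. apply RInt_line_ext_except_0; auto. intros t Ht. now rewrite E.
Qed.

Lemma is_derive_mellin_barnes (c w C0 : R) (G : R -> C) :
  Ccont G -> (forall t, (Cmod (G t) <= C0 / (1 + t ^ 2) ^ 2)%R) ->
  is_derive (mellin_barnes c G) w (mellin_barnes c (fun t => (c, t) * G t) w).
Proof.
  intros HG HC.
  assert (HC0 : (0 <= C0)%R).
  { generalize (HC 0%R) (Cmod_ge_0 (G 0%R)).
    replace (C0 / (1 + 0 ^ 2) ^ 2)%R with C0 by field. lra. }
  apply (is_derive_RInt_line (fun w t => fst (G t * cexp_line c w t))
    (fun w t => fst ((c, t) * G t * cexp_line c w t))
    (fun w t => fst ((c, t) * ((c, t) * G t) * cexp_line c w t))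
    w (C0 * (c ^ 2 + 1) * exp (Rabs c * (Rabs w + 1)))).
  - intros x. destruct (ex_mellin_barnes c x C0 G 0 ltac:(lia) HG HC) as [l Hl]. exists l.
    eapply is_RInt_gen_ext; [|exact Hl]. apply filter_prod_line. intros a b _ _ t _. simpl Cpow.
    now rewrite Cmult_1_l.
  - destruct (ex_mellin_barnes c w C0 G 1 ltac:(lia) HG HC) as [l Hl]. exists l.
    eapply is_RInt_gen_ext; [|exact Hl]. apply filter_prod_line. intros a b _ _ t _. simpl Cpow.
    now rewrite Cmult_1_r.
  - intros; apply is_derive_cexp_line.
  - intros; apply (is_derive_cexp_line ((c, t) * G t)).
  - intros x t Hx. eapply Rle_trans; [apply re_le_Cmod|].
    rewrite !Cmod_mult, Cmod_cexp_line.
    apply Rle_trans with (C0 * (c ^ 2 + 1) * exp (c * x) / (1 + t ^ 2))%R.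
    + replace (Cmod (c, t) * (Cmod (c, t) * Cmod (G t)))%R with (Cmod (c, t) ^ 2 * Cmod (G t))%R by ring.
      apply mellin_integrand_le; auto.
    + unfold Rdiv. apply Rmult_le_compat_r.
      { left; apply Rinv_0_lt_compat. generalize (pow2_ge_0 t); lra. }
      apply Rmult_le_compat_l. { generalize (pow2_ge_0 c). nra. }
      (* As |x - w| <= 1, the exponent c x is at most |c| (|w| + 1), a bound free of x. *)
      apply exp_le. eapply Rle_trans; [apply Rle_abs|]. rewrite Rabs_mult.
      apply Rmult_le_compat_l. apply Rabs_pos.
      replace x with ((x - w) + w)%R by ring. eapply Rle_trans; [apply Rabs_triang|]. lra.
Qed.

(** * The generalized-K distribution *)

Definition gamma_pair (k m c t : R) : C := CGamma (k - c, - t)%R * CGamma (m - c, - t)%R.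

Lemma Ccont_gamma_pair (k m c : R) : (c < k)%R -> (c < m)%R -> Ccont (gamma_pair k m c).
Proof.
  intros Hk Hm. unfold gamma_pair.
  apply (Ccont_mult (fun t => CGamma (k - c, - t)%R) (fun t => CGamma (m - c, - t)%R)).
  - apply (Ccont_comp_opp (fun t => CGamma (k - c, t)%R)), Ccont_CGamma. lra.
  - apply (Ccont_comp_opp (fun t => CGamma (m - c, t)%R)), Ccont_CGamma. lra.
Qed.

Lemma gamma_pair_decay (k m c : R) : (c < k)%R -> (c < m)%R ->
  exists K, forall t, (Cmod (gamma_pair k m c t) <= K / (1 + t ^ 2) ^ 2)%R.
Proof.
  intros Hk Hm.
  destruct (CGamma_decay (k - c)) as (K1 & HK1 & H1); [lra|].
  destruct (CGamma_decay (m - c)) as (K2 & HK2 & H2); [lra|].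
  exists (K1 * K2)%R. intros t. unfold gamma_pair. rewrite Cmod_mult.
  specialize (H1 (- t)%R). specialize (H2 (- t)%R).
  replace ((- t) ^ 2)%R with (t ^ 2)%R in * by ring.
  assert (Ht : (0 < 1 + t ^ 2)%R) by (generalize (pow2_ge_0 t); lra).
  replace (K1 * K2 / (1 + t ^ 2) ^ 2)%R with (K1 / (1 + t ^ 2) * (K2 / (1 + t ^ 2)))%R by (field; lra).
  apply Rmult_le_compat; auto using Cmod_ge_0.
Qed.

Lemma line_nonzero (c t : R) : (0 < c)%R -> ((c, t) : C) <> 0.
Proof. intros Hc E. apply (f_equal fst) in E. simpl in E. lra. Qed.

(** On the contour |s| >= c, so dividing by s costs at most the factor 1/c. *)
Lemma gamma_pair_div_decay (k m c : R) : (0 < c)%R -> (c < k)%R -> (c < m)%R ->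
  exists K, forall t, (Cmod (gamma_pair k m c t / (c, t)) <= K / (1 + t ^ 2) ^ 2)%R.
Proof.
  intros Hc Hk Hm. destruct (gamma_pair_decay k m c Hk Hm) as [K HK].
  exists (K / c)%R. intros t. specialize (HK t).
  rewrite Cmod_div by (apply line_nonzero; auto).
  assert (Ht : (0 < 1 + t ^ 2)%R) by (generalize (pow2_ge_0 t); lra).
  replace (K / c / (1 + t ^ 2) ^ 2)%R with (K / (1 + t ^ 2) ^ 2 * / c)%R by (field; lra).
  apply Rmult_le_compat; auto using Cmod_ge_0.
  - left. apply Rinv_0_lt_compat, Cmod_gt_0, line_nonzero; auto.
  - apply Rinv_le_contravar; auto. apply (fst_le_Cmod (c, t)).
Qed.

Lemma Ccont_gamma_pair_div (k m c : R) : (0 < c)%R -> (c < k)%R -> (c < m)%R ->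
  Ccont (fun t => gamma_pair k m c t / (c, t)).
Proof.
  intros Hc Hk Hm. apply Ccont_mult. apply Ccont_gamma_pair; auto.
  apply Ccont_inv. intros; apply line_nonzero; auto. apply Ccont_line.
Qed.

(** The midpoint of the strip 0 < Re s < min(k, m). The order [Rmin m k] is the one that the fold in
    [meijer_hi] produces. *)
Definition contour (k m : R) : R := (Rmin m k / 2)%R.

Lemma contour_spec (k m : R) : (0 < k)%R -> (0 < m)%R ->
  (0 < contour k m /\ contour k m < k /\ contour k m < m)%R.
Proof.
  intros Hk Hm. unfold contour.
  generalize (Rmin_l m k) (Rmin_r m k) (Rmin_pos m k Hm Hk). lra.
Qed.

Lemma CGamma_minus_line (k c t : R) : CGamma (k - (c, t)) = CGamma (k - c, - t)%R.
Proof. f_equal. unfold Cminus, Cplus, Copp, RtoC; simpl. f_equal; ring. Qed.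

Lemma MeijerG_21 (k m z : R) : (0 < k)%R -> (0 < m)%R ->
  MeijerG 2 1 [1%R] [k; m; 0%R] z =
  (/ (2 * PI) * mellin_barnes (contour k m) (fun t => gamma_pair k m (contour k m) t / (contour k m, t))%C (ln z))%R.
Proof.
  intros Hk Hm. destruct (contour_spec k m Hk Hm) as (Hc & Hck & Hcm).
  unfold MeijerG.
  replace (meijer_c 2 1 [1%R] [k; m; 0%R]) with (contour k m)
    by (unfold meijer_c, contour; simpl; field).
  set (c := contour k m) in *. f_equal.
  apply RInt_line_ext_except_0.
  - intros t _. f_equal. unfold meijer_integrand. simpl firstn. simpl skipn. cbn [map Cprod fold_right].
    unfold Cprod; cbn [fold_right]. rewrite !CGamma_minus_line.
    replace (RtoC (1 - 1) + (c, t)) with ((c, t) : C) by (unfold Cplus, RtoC; simpl; f_equal; ring).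
    replace (RtoC (1 - 0) + (c, t)) with ((c, t) + 1) by (unfold Cplus, RtoC; simpl; f_equal; ring).
    assert (N0 := line_nonzero c t Hc).
    assert (N1 : CGamma ((c, t) + 1) <> 0) by (apply CGamma_nonzero; simpl; lra).
    rewrite (CGamma_shift (c, t)) by (simpl; auto; lra).
    change (cpowR z (c, t)) with (cexp_line c (ln z) t). unfold gamma_pair.
    field. auto.
  - destruct (gamma_pair_div_decay k m c Hc Hck Hcm) as [K HK].
    destruct (ex_mellin_barnes c (ln z) K _ 0 ltac:(lia) (Ccont_gamma_pair_div k m c Hc Hck Hcm) HK) as [l Hl].
    exists l. eapply is_RInt_gen_ext; [|exact Hl]. apply filter_prod_line. intros a b _ _ t _. simpl Cpow.
    now rewrite Cmult_1_l.
Qed.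

Lemma MeijerG_22 (k m z : R) : (0 < k)%R -> (0 < m)%R ->
  let c := contour k m in
  MeijerG 2 2 [0%R; 1%R] [k; m; 0%R; 2%R] z =
  (/ (2 * PI) * (mellin_barnes c (fun t => (c, t) * gamma_pair k m c t)%C (ln z)
    - mellin_barnes c (gamma_pair k m c) (ln z)))%R.
Proof.
  intros Hk Hm c. destruct (contour_spec k m Hk Hm) as (Hc & Hck & Hcm). fold c in Hc, Hck, Hcm.
  unfold MeijerG.
  replace (meijer_c 2 2 [0%R; 1%R] [k; m; 0%R; 2%R]) with c.
  (* The parameters a = 0 and a = 1 give the lower ends -1 and 0, of which 0 is the larger. *)
  2: { unfold meijer_c, c, contour; simpl. rewrite Rmax_left by lra. field. }
  f_equal.
  destruct (gamma_pair_decay k m c Hck Hcm) as [K HK].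
  assert (I0 : is_RInt_line (fun t => fst (gamma_pair k m c t * cexp_line c (ln z) t)) (mellin_barnes c (gamma_pair k m c) (ln z))).
  { apply is_RInt_line_correct.
    destruct (ex_mellin_barnes c (ln z) K _ 0 ltac:(lia) (Ccont_gamma_pair k m c Hck Hcm) HK) as [l Hl].
    exists l. eapply is_RInt_gen_ext; [|exact Hl]. apply filter_prod_line. intros a b _ _ t _. simpl Cpow.
    now rewrite Cmult_1_l. }
  assert (I1 : is_RInt_line (fun t => fst ((c, t) * gamma_pair k m c t * cexp_line c (ln z) t))
     (mellin_barnes c (fun t => (c, t) * gamma_pair k m c t) (ln z))).
  { apply is_RInt_line_correct.
    destruct (ex_mellin_barnes c (ln z) K _ 1 ltac:(lia) (Ccont_gamma_pair k m c Hck Hcm) HK) as [l Hl].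
    exists l. eapply is_RInt_gen_ext; [|exact Hl]. apply filter_prod_line. intros a b _ _ t _. simpl Cpow.
    now rewrite Cmult_1_r. }
  assert (I : is_RInt_line (fun t => (fst ((c, t) * gamma_pair k m c t * cexp_line c (ln z) t)%C
      - fst (gamma_pair k m c t * cexp_line c (ln z) t)%C)%R)
    (mellin_barnes c (fun t => (c, t) * gamma_pair k m c t)%C (ln z)
      - mellin_barnes c (gamma_pair k m c) (ln z))%R)
    by exact (is_RInt_gen_minus _ _ _ _ I1 I0).
  rewrite <- (is_RInt_line_unique _ _ I).
  apply RInt_line_ext_except_0; [|eexists; exact I].
  intros t Ht. symmetry. unfold meijer_integrand. simpl firstn. simpl skipn. cbn [map].
  unfold Cprod; cbn [fold_right]. rewrite !CGamma_minus_line.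
  replace (RtoC (1 - 1) + (c, t)) with ((c, t) : C) by (unfold Cplus, RtoC; simpl; f_equal; ring).
  replace (RtoC (1 - 0) + (c, t)) with ((c, t) + 1) by (unfold Cplus, RtoC; simpl; f_equal; ring).
  replace (RtoC (1 - 2) + (c, t)) with ((c, t) - 1) by (unfold Cminus, Cplus, RtoC; simpl; f_equal; ring).
  assert (N0 : CGamma (c, t) <> 0) by (apply CGamma_nonzero; simpl; lra).
  assert (N1 : CGamma ((c, t) + 1) <> 0) by (apply CGamma_nonzero; simpl; lra).
  (* Here t <> 0 is essential, since c may be 1. *)
  assert (N2 : (c, t) - 1 <> 0).
  { intros E. apply (f_equal snd) in E. simpl in E. lra. }
  rewrite (CGamma_shift ((c, t) - 1)) by (simpl; auto; lra).
  replace ((c, t) - 1 + 1) with ((c, t) : C) by (unfold Cminus, Cplus, Copp, RtoC; simpl; f_equal; ring).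
  change (cpowR z (c, t)) with (cexp_line c (ln z) t). unfold gamma_pair.
  match goal with |- _ = (fst ?x - fst ?y)%R => change (fst x - fst y)%R with (fst (x - y)) end.
  f_equal. field. auto.
Qed.

(** * Moments and variance of the generalized-K distribution *)

Lemma gamma_unit_pdf_moment (k y : R) (j : nat) : (0 < k)%R -> (0 < y)%R ->
  (y ^ j * gamma_unit_pdf k y = / (k ^ j * Gamma k) * euler_weight (k + INR j) k y)%R.
Proof.
  intros Hk Hy. assert (HG := Gamma_pos k Hk).
  unfold gamma_unit_pdf, euler_weight.
  (* With rate mu = k, the weight (k y)^(k+j-1) exp(-k y) k absorbs k^k and y^j up to the factor
     k^j. *)
  rewrite <- Rpower_mult_distr by auto.
  replace (k + INR j - 1)%R with ((k - 1) + INR j)%R by ring.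
  rewrite !Rpower_plus, !Rpower_pow by auto.
  rewrite <- (Rpower_pred k k Hk). field. split; [lra|]. apply pow_nonzero; lra.
Qed.

Definition gamma_moment (k : R) (j : nat) : R := (/ (k ^ j * Gamma k) * euler_int (k + INR j) k)%R.

Lemma is_RInt_gamma_moment (k : R) (j : nat) : (0 < k)%R ->
  is_RInt_half (fun y => y ^ j * gamma_unit_pdf k y)%R (gamma_moment k j).
Proof.
  intros Hk. eapply is_RInt_gen_ext.
  2: { apply (is_RInt_gen_scal (V := R_NormedModule) (euler_weight (k + INR j) k) (/ (k ^ j * Gamma k))%R).
       apply is_RInt_half_correct, (ex_RInt_half_euler (k + INR j) k); auto.
       generalize (pos_INR j). lra. }
  apply filter_prod_half. simpl. intros a b Ha Hb y. rewrite Rmin_left by lra. intros Hy.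
  unfold scal; simpl; unfold mult; simpl. symmetry. apply gamma_unit_pdf_moment; auto; lra.
Qed.

Lemma gamma_moment_1 (k : R) : (0 < k)%R -> gamma_moment k 1 = 1%R.
Proof.
  intros Hk. unfold gamma_moment. assert (HG := Gamma_pos k Hk). simpl INR.
  rewrite euler_int_succ, <- Gamma_euler by auto. field. lra.
Qed.

Lemma gamma_moment_2 (k : R) : (0 < k)%R -> gamma_moment k 2 = ((k + 1) / k)%R.
Proof.
  intros Hk. unfold gamma_moment. assert (HG := Gamma_pos k Hk). simpl INR.
  replace (k + (1 + 1))%R with (k + 1 + 1)%R by ring.
  rewrite !euler_int_succ, <- Gamma_euler by (auto; lra). field. lra.
Qed.

Lemma genK_moment_eq (k m g : R) (j : nat) : (0 < k)%R -> (0 < m)%R ->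
  genK_moment k m g j = (g ^ j * gamma_moment k j * gamma_moment m j)%R.
Proof.
  intros Hk Hm. unfold genK_moment. apply is_RInt_half_unique.
  eapply is_RInt_gen_ext.
  2: { replace (g ^ j * gamma_moment k j * gamma_moment m j)%R
         with (scal (g ^ j * gamma_moment m j)%R (gamma_moment k j))
         by (unfold scal; simpl; unfold mult; simpl; ring).
       apply (is_RInt_gen_scal (V := R_NormedModule)), is_RInt_gamma_moment; auto. }
  (* For fixed x the inner integral is the j-th moment of Y times a factor in x, so the double
     integral splits into a product. *)
  apply filter_prod_half. intros a b _ _ x _. symmetry. apply is_RInt_half_unique.
  eapply is_RInt_gen_ext.
  2: { unfold scal at 1; simpl; unfold mult; simpl.
       replace (g ^ j * gamma_moment m j * (x ^ j * gamma_unit_pdf k x))%R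
         with (scal (g ^ j * (x ^ j * gamma_unit_pdf k x))%R (gamma_moment m j))
         by (unfold scal; simpl; unfold mult; simpl; ring).
       apply (is_RInt_gen_scal (V := R_NormedModule)), is_RInt_gamma_moment; auto. }
  apply filter_prod_half. intros a' b' _ _ y _. unfold scal; simpl; unfold mult; simpl.
  rewrite !Rpow_mult_distr. ring.
Qed.

Lemma genK_var_eq (k m g : R) : (0 < k)%R -> (0 < m)%R ->
  genK_var k m g = (g ^ 2 * ((k + 1) * (m + 1) / (k * m) - 1))%R.
Proof.
  intros Hk Hm. unfold genK_var.
  rewrite !genK_moment_eq, !gamma_moment_1, !gamma_moment_2 by auto. field. lra.
Qed.

Close Scope C_scope.

(** * Second derivative of the distribution function *)

Lemma genK_cdf_eq (k m g x : R) : 0 < k -> 0 < m -> 0 <= x ->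
  let c := contour k m in
  genK_cdf k m g x = / (2 * PI) / (Gamma k * Gamma m) *
    mellin_barnes c (fun t => Cdiv (gamma_pair k m c t) (c, t)) (ln (k * m * x / g)).
Proof.
  intros Hk Hm Hx c. unfold genK_cdf. destruct (Rle_dec 0 x); [|contradiction].
  rewrite MeijerG_21 by auto. fold c. unfold Rdiv. ring.
Qed.

(** The scale q/g only adds a constant to the logarithm, so the inner derivative is a / (b + a
    x). *)
Lemma is_derive_comp_ln_affine (f : R -> R) (a b g q x l : R) :
  0 < g -> 0 < q -> 0 < b + a * x ->
  is_derive f (ln (q * (b + a * x) / g)) l ->
  is_derive (fun x => f (ln (q * (b + a * x) / g))) x (l * (a / (b + a * x))).
Proof.
  intros Hg Hq Hx Hf. rewrite Rmult_comm.
  apply (is_derive_comp f (fun x => ln (q * (b + a * x) / g))); auto.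
  auto_derive.
  - apply Rdiv_lt_0_compat; nra.
  - field. repeat split; nra.
Qed.

(** Put X = b + a x and let F be the Mellin-Barnes integral of [gamma_pair]. The first derivative is
    a constant times F(w) a / X with dw/dx = a / X. Differentiating again gives (F'(w) - F(w)) (a /
    X)^2: the term -F comes from the factor 1/X and turns s into s - 1. *)
Lemma Derive2_genK_cdf (k m g a b x : R) : 0 < k -> 0 < m -> 0 < g -> 0 < b + a * x ->
  Derive_n (fun x => genK_cdf k m g (b + a * x)) 2 x =
  / (Gamma k * Gamma m) * (a / (b + a * x)) ^ 2 * MeijerG 2 2 [0; 1] [k; m; 0; 2] (k * m * (b + a * x) / g).
Proof.
  intros Hk Hm Hg Hx. destruct (contour_spec k m Hk Hm) as (Hc & Hck & Hcm).
  set (c := contour k m) in *. set (M := / (2 * PI) / (Gamma k * Gamma m)).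
  destruct (gamma_pair_decay k m c Hck Hcm) as [K1 HK1].
  destruct (gamma_pair_div_decay k m c Hc Hck Hcm) as [K0 HK0].
  (* [genK_cdf] is 0 by cases on negative arguments, so its integral formula must hold on a whole
     neighbourhood before it is differentiated. *)
  assert (Hloc : forall x, 0 < b + a * x -> locally x (fun y => 0 < b + a * y)).
  { intros y Hy. apply (continuous_comp (fun y => b + a * y) (fun z => z) y).
    - apply @ex_derive_continuous. auto_derive; auto.
    - apply continuous_id.
    - exists (mkposreal _ Hy). intros z Hz.
      apply ball_R_between in Hz; simpl in Hz. lra. }
  assert (Hq : 0 < k * m) by nra.
  (* The factor s from the first differentiation cancels the 1/s of the distribution function. *)
  assert (E1 : forall w, mellin_barnes c (fun t => Cmult (c, t) (Cdiv (gamma_pair k m c t) (c, t))) w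
     = mellin_barnes c (gamma_pair k m c) w).
  { intros w. apply mellin_barnes_ext.
    - intros t _. field. apply line_nonzero; auto.
    - destruct (ex_mellin_barnes c w K1 _ 0 ltac:(lia) (Ccont_gamma_pair k m c Hck Hcm) HK1) as [l Hl].
      exists l. eapply is_RInt_gen_ext; [|exact Hl]. apply filter_prod_line. intros u v _ _ t _. simpl Cpow.
      now rewrite Cmult_1_l. }
  assert (D1 : forall x, 0 < b + a * x -> Derive (fun x => genK_cdf k m g (b + a * x)) x =
     M * (mellin_barnes c (gamma_pair k m c) (ln (k * m * (b + a * x) / g)) * (a / (b + a * x)))).
  { intros y Hy. apply is_derive_unique.
    apply is_derive_ext_loc with (fun x => M * mellin_barnes c (fun t => Cdiv (gamma_pair k m c t) (c, t)) (ln (k * m * (b + a * x) / g))).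
    - generalize (Hloc y Hy). apply filter_imp. intros z Hz. symmetry. apply genK_cdf_eq; auto; lra.
    - apply is_derive_scal. rewrite <- E1.
      apply (is_derive_comp_ln_affine (mellin_barnes c (fun t => Cdiv (gamma_pair k m c t) (c, t)))); auto.
      apply is_derive_mellin_barnes with K0; auto. apply Ccont_gamma_pair_div; auto. }
  change (Derive_n (fun x => genK_cdf k m g (b + a * x)) 2 x)
    with (Derive (fun y => Derive (fun x => genK_cdf k m g (b + a * x)) y) x).
  rewrite (Derive_ext_loc _ (fun x => M * (mellin_barnes c (gamma_pair k m c) (ln (k * m * (b + a * x) / g)) * (a / (b + a * x))))).
  2: { generalize (Hloc x Hx). apply filter_imp. exact D1. }
  apply is_derive_unique.
  rewrite MeijerG_22 by auto. fold c.
  set (L := ln (k * m * (b + a * x) / g)).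
  evar_last.
  - apply is_derive_scal. apply (is_derive_mult (K := R_AbsRing)).
    + apply (is_derive_comp_ln_affine (mellin_barnes c (gamma_pair k m c))); auto.
      apply is_derive_mellin_barnes with K1; auto. apply Ccont_gamma_pair; auto.
    + instantiate (1 := - (a / (b + a * x)) ^ 2). auto_derive. lra. field. lra.
    + intros; apply Rmult_comm.
  - unfold plus, mult, scal; simpl; unfold mult; simpl. fold L. unfold M.
    assert (HG1 := Gamma_pos k Hk). assert (HG2 := Gamma_pos m Hm). assert (HPI := PI_RGT_0).
    field. repeat split; lra.
Qed.

Theorem theorem1 (Rs md kd gd me ke ge : R) :
  0 < Rs -> 0 < md -> 0 < kd -> 0 < gd -> 0 < me -> 0 < ke -> 0 < ge ->
  let lam := Rpower 2 Rs in
  let P := fun x => genK_cdf kd md gd (lam - 1 + lam * x) in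
  let sigma2 := genK_var ke me ge in
  P ge + sigma2 / 2 * Derive_n P 2 ge =
    MeijerG 2 1 [1] [kd; md; 0] (kd * md * (lam - 1 + lam * ge) / gd)
      / (Gamma kd * Gamma md)
    + ge ^ 2 * lam ^ 2 *
      (((ke + 1) * (me + 1) / (ke * me) - 1)
        * MeijerG 2 2 [0; 1] [kd; md; 0; 2] (kd * md * (lam - 1 + lam * ge) / gd))
      / (2 * Gamma kd * Gamma md * (lam - 1 + lam * ge) ^ 2).
Proof.
  intros HRs Hmd Hkd Hgd Hme Hke Hge lam P sigma2.
  (* This puts the point of expansion at a positive argument of the distribution function, where it
     is smooth. *)
  assert (Hlam : 1 < lam).
  { unfold lam. rewrite <- (Rpower_O 2) by lra. apply Rpower_lt; lra. }
  assert (Hx : 0 < lam - 1 + lam * ge) by nra.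
  assert (HG1 := Gamma_pos kd Hkd). assert (HG2 := Gamma_pos md Hmd).
  unfold P, sigma2. rewrite Derive2_genK_cdf, genK_var_eq by (auto; lra).
  unfold genK_cdf at 1. destruct (Rle_dec 0 (lam - 1 + lam * ge)) as [_|Hn]; [|lra].
  field. repeat split; lra.
Qed.
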